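(* Let $n\geq 1$, let $f:\mathbb{R}^n\to\mathbb{R}$ be a $C^2$ function whose Hessian matrix is positive definite at every point of $\mathbb{R}^n$, and suppose $\int_{\mathbb{R}^n}e^{-f(x)}\,\mathrm{d}^n x=1$. Let $\mu$ be the probability measure with log-concave density $\mathrm{d}\mu=e^{-f(x)}\,\mathrm{d}^n x$. Then for every locally Lipschitz function $h:\mathbb{R}^n\to\mathbb{R}$, $$\int_{\mathbb{R}^n}\int_{\mathbb{R}^n}\frac{|h(x)-h(y)|}{|x-y|}\,\mathrm{d}\mu(x)\,\mathrm{d}\mu(y)\;\leq\;2^n\int_{\mathbb{R}^n}|\nabla h(x)|\,\mathrm{d}\mu(x).$$
   Context: Here $|\cdot|$ denotes the Euclidean norm on $\mathbb{R}^n$ (and absolute value on $\mathbb{R}$). The gradient of a locally Lipschitz function exists almost everywhere, and both sides of the inequality are understood as elements of $[0,\infty]$. *)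

(* Defs.v *)
From HB Require Import structures.
From mathcomp Require Import all_boot all_order all_algebra.
From mathcomp Require Import all_classical all_reals all_analysis.

Set Implicit Arguments.
Unset Strict Implicit.
Unset Printing Implicit Defensive.

Import Order.TTheory GRing.Theory Num.Theory.
Import numFieldNormedType.Exports.

Local Open Scope classical_set_scope.
Local Open Scope ring_scope.

(* R^n is 'rV[R]_n, with the topology of the library and the product
   sigma-algebra generated by the coordinates, which is the Borel one.  This
   mirrors the instance of the library on n.-tuple T. *)
Definition measure_rV_display : measure_display -> measure_display.
Proof. exact. Qed.

Section measurable_rV.
Context {d} {T : measurableType d} {n : nat}.

Let coor : 'I_n -> 'rV[T]_n -> T := fun i x => x ord0 i.

Let rV_set0 : g_sigma_preimage coor set0.
Proof. exact: sigma_algebra0. Qed.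

Let rV_setC A : g_sigma_preimage coor A -> g_sigma_preimage coor (~` A).
Proof. exact: sigma_algebraC. Qed.

Let rV_bigcup (F : _^nat) : (forall i, g_sigma_preimage coor (F i)) ->
  g_sigma_preimage coor (\bigcup_i (F i)).
Proof. exact: sigma_algebra_bigcup. Qed.

HB.instance Definition _ := @isMeasurable.Build (measure_rV_display d)
  'rV[T]_n (g_sigma_preimage coor) rV_set0 rV_setC rV_bigcup.

End measurable_rV.
Section measurable_rV_theory.
Context d1 d2 (T1 : measurableType d1) (T2 : measurableType d2) (n : nat).

Lemma measurable_coord (i : 'I_n) :
  measurable_fun [set: 'rV[T2]_n] (fun x => x ord0 i).
Proof.
move=> _ Y mY; rewrite setTI; apply: sub_sigma_algebra => /=.
rewrite -bigcup_seq/=; exists i => /=; first by rewrite mem_index_enum.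
by exists Y => //; rewrite setTI.
Qed.

Lemma measurable_fun_rV (f : T1 -> 'rV[T2]_n) :
  (forall i, measurable_fun [set: T1] (fun x => f x ord0 i)) ->
  measurable_fun [set: T1] f.
Proof.
move=> mf.
have prefS : g_sigma_preimage (fun i x => f x ord0 i) `<=` measurable.
  apply: smallest_sub; first exact: sigma_algebra_measurable.
  case: n => [|m] in f mf *; first by rewrite big_ord0.
  rewrite -bigcup_mkord_ord; apply: bigcup_sub => i Ii.
  by move=> A [B mB <-]; exact: mf.
move=> _ A mA; apply: prefS.
rewrite (g_sigma_preimage_comp (fun i (x : 'rV[T2]_n) => x ord0 i) f).
by exists A.
Qed.

End measurable_rV_theory.

Section lebesgue_rV.
Context {R : realType}.

Definition rV_cons n (p : measurableTypeR R * 'rV[R]_n) : 'rV[R]_n.+1 :=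
  row_mx p.1%:M p.2.

Definition rV_uncons n (x : 'rV[R]_n.+1) : measurableTypeR R * 'rV[R]_n :=
  (x ord0 ord0, \row_i x ord0 (lift ord0 i)).

Lemma rV_cons0 n p : @rV_cons n p ord0 ord0 = p.1.
Proof.
rewrite /rV_cons mxE; case: splitP => [j _|//].
by rewrite mxE (ord1 j) eqxx mulr1n.
Qed.

Lemma rV_consS n p i : @rV_cons n p ord0 (lift ord0 i) = p.2 ord0 i.
Proof.
rewrite /rV_cons mxE; case: splitP => [[[]]//|j /=].
by rewrite /bump /= => -[/val_inj ->].
Qed.

Lemma rV_consK n : cancel (@rV_cons n) (@rV_uncons n).
Proof.
move=> [a x]; rewrite /rV_uncons rV_cons0; congr pair.
by apply/rowP => i; rewrite mxE rV_consS.
Qed.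

Lemma rV_unconsK n : cancel (@rV_uncons n) (@rV_cons n).
Proof.
move=> x; apply/rowP => i; have [j ->|->] := unliftP ord0 i.
  by rewrite rV_consS mxE.
by rewrite rV_cons0.
Qed.

Lemma measurable_rV_cons n : measurable_fun setT (@rV_cons n).
Proof.
apply: measurable_fun_rV => i; have [j ->|->] := unliftP ord0 i.
  rewrite [X in measurable_fun _ X](_ : _ = (fun x : 'rV[R]_n => x ord0 j) \o snd).
    by apply: measurableT_comp; [exact: measurable_coord|exact: measurable_snd].
  by apply/funext => p /=; rewrite rV_consS.
rewrite [X in measurable_fun _ X](_ : _ = fst); first exact: measurable_fst.
by apply/funext => p /=; rewrite rV_cons0.
Qed.

Lemma measurable_rV_uncons n : measurable_fun setT (@rV_uncons n).
Proof.
apply: measurable_fun_pair; first exact: measurable_coord.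
apply: measurable_fun_rV => i.
under eq_fun do rewrite mxE.
exact: measurable_coord.
Qed.

Section step.
Variables (n : nat) (m : {sigma_finite_measure set 'rV[R]_n -> \bar R}).

Definition lebesgue_rV_step : set 'rV[R]_n.+1 -> \bar R :=
  pushforward (lebesgue_measure \x m)%E (@rV_cons n).

Let step0 : lebesgue_rV_step set0 = 0%E.
Proof. by rewrite /lebesgue_rV_step /pushforward preimage_set0 measure0. Qed.

Let step_ge0 A : (0 <= lebesgue_rV_step A)%E.
Proof. by rewrite /lebesgue_rV_step /pushforward; exact: measure_ge0. Qed.

Let step_sigma_additive : semi_sigma_additive lebesgue_rV_step.
Proof.
move=> F mF tF mUF.
have mcons A : measurable A -> measurable (@rV_cons n @^-1` A).
  by move=> mA; rewrite -[X in measurable X]setTI; exact: measurable_rV_cons.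
rewrite /lebesgue_rV_step /pushforward preimage_bigcup.
apply: measure_semi_sigma_additive => [k||]; first exact: mcons.
- apply/trivIsetP => i j _ _ ij; rewrite -preimage_setI.
  by move/trivIsetP : tF => /(_ _ _ _ _ ij) ->//; rewrite preimage_set0.
- by rewrite -preimage_bigcup; exact: mcons.
Qed.

HB.instance Definition _ := isMeasure.Build _ _ _ lebesgue_rV_step
  step0 step_ge0 step_sigma_additive.

Let step_sigma_finite : sigma_finite setT lebesgue_rV_step.
Proof.
have /sigma_finiteP[F [FT ndF Foo]] := sigma_finiteT (@lebesgue_measure R).
have /sigma_finiteP[G [GT ndG Goo]] := sigma_finiteT m.
have FG k : lebesgue_rV_step (@rV_uncons n @^-1` (F k `*` G k)) =
    (lebesgue_measure (F k) * m (G k))%E.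
  have [mF _] := Foo k; have [mG _] := Goo k.
  rewrite -product_measure1E// /lebesgue_rV_step /pushforward -comp_preimage.
  rewrite (_ : _ \o _ = id)//; last by apply/funext => p /=; rewrite rV_consK.
exists (fun k => @rV_uncons n @^-1` (F k `*` G k)).
  apply/seteqP; split => // x _.
  have [i _ Fi] : (\bigcup_i F i) (rV_uncons x).1 by rewrite -FT.
  have [j _ Gj] : (\bigcup_i G i) (rV_uncons x).2 by rewrite -GT.
  exists (maxn i j) => //; split.
    by move: Fi; exact/subsetPset/ndF/leq_maxl.
  by move: Gj; exact/subsetPset/ndG/leq_maxr.
move=> k; have [mF Fk] := Foo k; have [mG Gk] := Goo k; split.
  rewrite -[X in measurable X]setTI; apply: measurable_rV_uncons => //.
  exact: measurableX.
by rewrite FG lte_mul_pinfty// ge0_fin_numE.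
Qed.

HB.instance Definition _ := Measure_isSigmaFinite.Build _ _ _ lebesgue_rV_step
  step_sigma_finite.

End step.

(* n-dimensional Lebesgue measure on Borel sets, as an iterated product; by
   lebesgue_rV_box it is the product of the one-dimensional measures. *)
Fixpoint lebesgue_rV n : {sigma_finite_measure set 'rV[R]_n -> \bar R} :=
  if n is k.+1 then lebesgue_rV_step (lebesgue_rV k) else dirac (0 : 'rV[R]_0).

Lemma lebesgue_rV_box n (A : 'I_n -> set (measurableTypeR R)) :
  (forall i, measurable (A i)) ->
  lebesgue_rV n [set x | forall i, A i (x ord0 i)] =
  (\prod_(i < n) lebesgue_measure (A i))%E.
Proof.
elim: n A => [|n IHn] A mA /=.
  rewrite big_ord0 diracE mem_set//.
  by case.
rewrite big_ord_recl -IHn//.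
pose B := [set x : 'rV[R]_n | forall i, A (lift ord0 i) (x ord0 i)].
have mB : measurable B.
  rewrite (_ : B = \big[setI/setT]_(i < n)
    ((fun x : 'rV[R]_n => x ord0 i) @^-1` A (lift ord0 i))).
    apply: bigsetI_measurable => i _; rewrite -[X in measurable X]setTI.
    by apply: measurable_coord => //; exact: mA.
  apply/seteqP; split=> [x Bx|x].
    by apply: (@big_ind _ (fun S : set 'rV[R]_n => S x)) => // i _; exact: Bx.
  by move=> + i; rewrite (bigD1 i)//= => -[].
rewrite -product_measure1E//.
rewrite /lebesgue_rV_step /pushforward; congr (_ _).
apply/seteqP; split => [[a x] /= h|[a x] /= [ha hx] i].
  split; first by have := h ord0; rewrite rV_cons0.
  by move=> i; have := h (lift ord0 i); rewrite rV_consS.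
have [j ->|->] := unliftP ord0 i; first by rewrite rV_consS; exact: hx.
by rewrite rV_cons0.
Qed.

End lebesgue_rV.

Section euclidean_calculus.
Context {R : realType} {n : nat}.
Implicit Types (x y v : 'rV[R]_n) (h : 'rV[R]_n -> R).

(* The norm that the library puts on 'rV[R]_n is the sup norm, hence a separate
   Euclidean norm. *)
Definition enorm x : R := Num.sqrt (\sum_(i < n) x ord0 i ^+ 2).

Definition basis_vec (i : 'I_n) : 'rV[R]_n := delta_mx ord0 i.

(* 'D_v h x is total: it takes a default value where the limit of the difference
   quotient does not exist.  For locally Lipschitz h that is a null set. *)
Definition gradient h x : 'rV[R]_n := \row_i 'D_(basis_vec i) h x.

Definition hessian h x : 'M[R]_n :=
  \matrix_(i, j) 'D_(basis_vec i) ('D_(basis_vec j) h) x.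

Fixpoint of_class_C (k : nat) h : Prop :=
  if k is k'.+1 then
    continuous h /\
    forall i, (forall x, derivable h x (basis_vec i)) /\
              of_class_C k' ('D_(basis_vec i) h)
  else continuous h.

Definition posdefmx (A : 'M[R]_n) : Prop :=
  A^T = A /\ forall v, v != 0 -> 0 < (v *m A *m v^T) ord0 ord0.

Definition locally_lipschitz h : Prop :=
  forall x, exists2 U, nbhs x U &
    exists k : R, forall y z, U y -> U z -> `|h y - h z| <= k * enorm (y - z).

End euclidean_calculus.

(* Main.v *)
Require Import Defs.
From HB Require Import structures.
From mathcomp Require Import all_boot all_order all_algebra.
From mathcomp Require Import all_classical all_reals all_analysis.
From mathcomp Require Import measurable_realfun ring lra.

Set Implicit Arguments.
Unset Strict Implicit.
Unset Printing Implicit Defensive.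

Import Order.TTheory GRing.Theory Num.Theory.
Import numFieldNormedType.Exports.

Local Open Scope classical_set_scope.
Local Open Scope ring_scope.

(** Write [rho = expR (- f)]; since the Hessian is positive definite, [f] is
    convex and [rho] is log-concave.

    The theorem rests on one pointwise inequality, [log_concave_pair]: with
    [z = (1 - t) x + t y],
    [rho x * rho y <= rho z * 2 ^ n * (t ^ (n+1) rho x + (1 - t) ^ (n+1) rho y)].
    Log-concavity bounds the left-hand side by
    [rho z * (rho x) ^ t * (rho y) ^ (1 - t)], and the weighted
    arithmetic-geometric mean inequality, applied to [t ^ n rho x] and
    [(1 - t) ^ n rho y], costs the factor
    [(t ^ (- t) * (1 - t) ^ (- (1 - t))) ^ n], the [n]-th power of the
    exponential of the entropy of a two-point law, which is at most [2 ^ n].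
    Multiply by [g z] for a nonnegative [g] and integrate over [x] and [y].  For
    fixed [x] the map [y |-> z] scales the volume by [t ^ n], and for fixed [y]
    the map [x |-> z] scales it by [(1 - t) ^ n], so the two terms contribute
    [t] and [1 - t] times the same integral.  Hence ([interpolation_le])
    the mean of [g z] over independent [x] and [y] is at most
    [2 ^ n] times the mean of [g], for every [t] strictly between 0 and 1.

    For smooth [h] the theorem follows at once: [h x - h y] is the integral over
    [t] of the derivative of [h] along the segment, so [|h x - h y| / |x - y|]
    is at most the integral over [t] of [|grad h| (z)], and
    [interpolation_le] applies for each [t] with [g = |grad h|].

    A locally Lipschitz [h] may be non-differentiable on whole segments, so
    it is mollified first.  For bounded Lipschitz [h], directional derivatives exist
    almost everywhere ([ae_derivable]), and by dominated convergence the
    convolution of [h] with a small tent function is C1, its partial derivatives being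
    the convolutions of those of [h] ([smoothing_is_derive]).  The argument above then
    bounds the difference quotient of the convolution by averages of [|grad h|]
    over small balls.  On a bounded box [rho] varies by a factor at most [1 + e] over small
    distances, so averaging costs only that factor ([integral_average_le]),
    and Fatou's lemma removes the mollifier ([ratio_box_le_eps]).

    Finally a locally Lipschitz function agrees on each box with a bounded
    Lipschitz one, obtained by composing with the projection onto a larger box
    ([ratio_box_le]), and the boxes exhaust the space. *)

(** * Directional derivatives, and convexity from the Hessian *)

Section directional_derivatives.
Context {R : realType} {V : normedModType R}.
Implicit Types (f : V -> R) (p v w x : V) (a s : R).

Lemma is_deriveE f x v l :
  is_derive x v f l <-> h^-1 *: (f (h *: v + x) - f x) @[h --> 0^'] --> l.
Proof.
split=> [[/cvg_ex[/= l' fl'] <-]|fl].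
  by rewrite (_ : 'D_v f x = l')//; exact/cvg_lim.
by split; [apply/cvg_ex; exists l|exact/cvg_lim].
Qed.

Lemma is_derive_line f p v s l :
  is_derive (p + s *: v) v f l <-> is_derive s 1 (fun r => f (p + r *: v)) l.
Proof.
rewrite is_deriveE.
suff -> : (fun h => h^-1 *: (f (h *: v + (p + s *: v)) - f (p + s *: v))) =
  (fun h => h^-1 *: (f (p + (h *: 1 + s) *: v) - f (p + s *: v))).
  split=> [fl|[/cvg_ex[/= l' fl'] <-]].
    by split; [apply/cvg_ex; exists l|exact/cvg_lim].
  by rewrite (_ : 'D_1 _ s = l')//; exact/cvg_lim.
by apply/funext => h; rewrite scalerDl [h *: 1]mulr1 addrCA.
Qed.

Lemma MVT_directional f p v s : (forall x, derivable f x v) ->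
  exists2 t, `|t| <= `|s| &
    f (p + s *: v) - f p = s * 'D_v f (p + t *: v).
Proof.
move=> df; pose g (r : R) := f (p + r *: v).
have dg (r : R) : is_derive r (1 : R) g ('D_v f (p + r *: v)).
  by apply/is_derive_line; exact: derivableP.
have cg a b : {within `[a, b], continuous g}.
  by apply: derivable_within_continuous => r _; have [] := dg r.
have g0 : g 0 = f p by rewrite /g scale0r addr0.
have [s0|s0] := leP 0 s.
  have [t tI] := MVT_segment s0 (fun r _ => dg r) (cg 0 s); rewrite -[g s]/(f (p + s *: v)).
  rewrite g0 subr0 mulrC => e; exists t; last exact: e.
  by move: tI; rewrite in_itv/= => /andP[t0 ts]; rewrite !ger0_norm.
have [t tI] := MVT_segment (ltW s0) (fun r _ => dg r) (cg s 0); rewrite -[g s]/(f (p + s *: v)).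
rewrite g0 sub0r => /(congr1 -%R); rewrite opprB mulrN opprK mulrC => e.
exists t; last exact: e.
move: tI; rewrite in_itv/= => /andP[st t0].
by rewrite !ler0_norm ?lerN2// ltW.
Qed.

(** Continuity is asked in one direction only: the increment along
    [u + w] is split at [x + h u], the mean value theorem is applied to the
    second leg, and its intermediate point tends to [x]. *)
Lemma is_derive_addv f x u w a : is_derive x u f a ->
  (forall y, derivable f y w) -> {for x, continuous ('D_w f)} ->
  is_derive x (u + w) f (a + 'D_w f x).
Proof.
move=> /is_deriveE fu dw cw; apply/is_deriveE.
have /choice[t tP] h : exists t, `|t| <= `|h| /\
    f (h *: u + x + h *: w) - f (h *: u + x) =
    h * 'D_w f (h *: u + x + t *: w).
  by have [t th e] := MVT_directional (h *: u + x) h dw; exists t.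
have fw : h^-1 *: (f (h *: u + x + h *: w) - f (h *: u + x)) @[h --> 0^'] -->
    'D_w f x.
  apply: (@cvg_trans _ ('D_w f (h *: u + x + t h *: w) @[h --> 0^'])).
    apply: near_eq_cvg; near=> h; have [_ ->] := tP h.
    by rewrite /GRing.scale/= mulrA mulVf ?mul1r//; near: h; exact: nbhs_dnbhs_neq.
  suff tx : h *: u + x + t h *: w @[h --> 0^'] --> x by exact: (cvg_comp _ _ tx cw).
  have -> : nbhs x = nbhs (0 *: u + x + 0 *: w).
    by rewrite !scale0r add0r addr0.
  have t0 : t h @[h --> 0^'] --> (0 : R).
    apply/cvgrPdist_le => e e0; near=> h.
    have [th _] := tP h; rewrite sub0r normrN (le_trans th)//.
    by near: h; apply: dnbhs0_le.
  apply: cvgD; last by apply: cvgZr_tmp; exact: t0.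
  by apply: cvgD; [apply: cvgZr_tmp; exact: cvg_within|exact: cvg_cst].
rewrite (_ : (fun _ => _) = (fun h => h^-1 *: (f (h *: u + x) - f x)) \+
  (fun h => h^-1 *: (f (h *: u + x + h *: w) - f (h *: u + x))))//.
  exact: cvgD.
apply/funext => h /=; rewrite -scalerDr; congr (_ *: _).
by rewrite [RHS]addrC subrKA scalerDr addrAC.
Unshelve. all: by end_near. Qed.

Lemma is_derive_scalev f x v a c : is_derive x v f a ->
  is_derive x (c *: v) f (c * a).
Proof.
have [-> _|c0 /is_deriveE fv] := eqVneq c 0.
  by rewrite scale0r mul0r; exact: is_derive0.
apply/is_deriveE.
rewrite (_ : (fun _ => _) = (fun h => c *: ((h * c)^-1 *: (f ((h * c) *: v + x) - f x)))).
  apply: cvgZl_tmp.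
  apply: (@cvg_comp _ _ _ (fun h => h * c) (fun k => k^-1 *: (f (k *: v + x) - f x))
    _ (0^')) => //.
  move=> A [e /= e0 eA]; exists (e / `|c|) => /=; first by rewrite divr_gt0 ?normr_gt0.
  move=> h /=; rewrite !sub0r !normrN => he h0; apply: eA => /=.
    by rewrite sub0r normrN normrM -ltr_pdivlMr ?normr_gt0.
  by rewrite mulf_neq0.
apply/funext => h; rewrite !scalerA; congr (_ *: _).
by have [->|h0] := eqVneq h 0; rewrite ?mul0r ?invr0 ?mulr0// invfM mulrCA mulfV ?mulr1.
Qed.

End directional_derivatives.

Section C1_functions.
Context {R : realType} {n : nat}.
Implicit Types (f : 'rV[R]_n -> R) (x v : 'rV[R]_n).

Lemma rV_basisE v : v = \sum_i v ord0 i *: basis_vec i.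
Proof. exact: row_sum_delta. Qed.

(** Chain rule: continuous partial derivatives give all directional ones,
    adding one coordinate of [v] at a time. *)
Lemma is_derive_C1 f :
  (forall i x, derivable f x (basis_vec i)) ->
  (forall i, continuous ('D_(basis_vec i) f)) ->
  forall x v, is_derive x v f (\sum_i v ord0 i * 'D_(basis_vec i) f x).
Proof.
move=> df cf x v; rewrite {1}(rV_basisE v).
elim: (index_enum _) => [|i s IHs]; first by rewrite !big_nil; exact: is_derive0.
rewrite !big_cons.
have dvi y : is_derive y (v ord0 i *: basis_vec i) f (v ord0 i * 'D_(basis_vec i) f y).
  exact/is_derive_scalev/derivableP.
have DE : 'D_(v ord0 i *: basis_vec i) f = fun y => v ord0 i * 'D_(basis_vec i) f y.
  by apply/funext => y; have [_] := dvi y.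
have -> : v ord0 i * 'D_(basis_vec i) f x = 'D_(v ord0 i *: basis_vec i) f x.
  by have [_ ->] := dvi x.
rewrite addrC [X in is_derive _ _ _ X]addrC.
apply: is_derive_addv => [y|]; first by have [] := dvi y.
rewrite DE; apply: continuousM; [exact: cst_continuous|exact: cf].
Qed.

(** Along a segment the second derivative of [f] is the Hessian form of the
    direction. *)
Lemma posdef_hessian_convex f : of_class_C 2 f ->
  (forall x, posdefmx (hessian f x)) ->
  forall x y (t : R), 0 <= t <= 1 ->
    f ((1 - t) *: x + t *: y) <= (1 - t) * f x + t * f y.
Proof.
move=> [_ C2f] Hf x y t t01; pose v := y - x; pose g (s : R) := f (x + s *: v).
have df i z : derivable f z (basis_vec i) by have [] := C2f i.
have cf i : continuous ('D_(basis_vec i) f) by have [_ []] := C2f i.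
have ddf i j z : derivable ('D_(basis_vec i) f) z (basis_vec j).
  by have [_ [_ /(_ j)[]]] := C2f i.
have cdf i j : continuous ('D_(basis_vec j) ('D_(basis_vec i) f)).
  by have [_ [_ /(_ j)[]]] := C2f i.
have dg (s : R) : is_derive s (1 : R) g (\sum_i v ord0 i * 'D_(basis_vec i) f (x + s *: v)).
  exact: (proj1 (is_derive_line f x v s _) (is_derive_C1 df cf _ _)).
have Dg : 'D_1 g = fun s => \sum_i v ord0 i * 'D_(basis_vec i) f (x + s *: v).
  by apply/funext => s; have [_] := dg s.
have ddg (s : R) : is_derive s (1 : R) ('D_1 g) (\sum_i v ord0 i *
    (\sum_j v ord0 j * 'D_(basis_vec j) ('D_(basis_vec i) f) (x + s *: v))).
  rewrite Dg.
  have -> : (fun s => \sum_i v ord0 i * 'D_(basis_vec i) f (x + s *: v)) =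
      \sum_i (v ord0 i \*: (fun s => 'D_(basis_vec i) f (x + s *: v))).
    by apply/funext => r; rewrite fct_sumE.
  apply: is_derive_sum => i; apply: is_deriveZ.
  exact: (proj1 (is_derive_line _ x v s _) (is_derive_C1 (ddf i) (cdf i) _ _)).
have ddg_ge0 s : 0 <= 'D_1 ('D_1 g) s.
  have [_ ->] := ddg s.
  have [->|v0] := eqVneq v 0.
    by rewrite big1// => i _; rewrite mxE mul0r.
  have [_ /(_ _ v0)/ltW] := Hf (x + s *: v).
  rewrite mxE; congr (_ <= _); apply: eq_bigr => j _.
  rewrite [in LHS]mxE mulrC [in LHS]mxE; congr (_ * _).
  by apply: eq_bigr => i _; rewrite !mxE.
have cg : continuous g.
  move=> s; apply: differentiable_continuous; apply/derivable1_diffP.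
  by have [] := dg s.
have t'0 : 0 <= 1 - t by rewrite subr_ge0; case/andP: t01.
have t'1 : 1 - t <= 1 by rewrite gerBl; case/andP: t01.
have := @second_derivative_convex R g 0 1 (fun s _ => ddg_ge0 s)
  (cvg_at_left_filter (cg 1)) (cvg_at_right_filter (cg 0))
  (fun s _ => let: DeriveDef d _ := dg s in d)
  (fun s _ => let: DeriveDef d _ := ddg s in d) (Itv01 t'0 t'1) ler01.
rewrite !convRE/= mulr0 add0r mulr1 /unstable.onem !subKr.
rewrite /g scale0r addr0 scale1r /v [x + (y - x)]addrC subrK.
rewrite (_ : _ + t *: _ = (1 - t) *: x + t *: y)//.
by rewrite scalerBl scale1r scalerBr addrA addrAC.
Qed.

End C1_functions.

(** * Measurability and affine changes of variables on row vectors *)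

Section measurable_rV.
Context {R : realType} {n : nat}.

(** Every open set is a countable union of rational boxes; so the product
    sigma-algebra contains the Borel sets. *)
Lemma open_measurable_rV (A : set 'rV[R]_n) : open A -> measurable A.
Proof.
move=> oA.
pose box (qk : {ffun 'I_n -> rat} * nat) :=
  [set x : 'rV[R]_n | forall i, `|ratr (qk.1 i) - x ord0 i| < qk.2.+1%:R^-1].
have mbox qk : measurable (box qk).
  rewrite (_ : box qk = \big[setI/setT]_(i < n)
    ((fun x : 'rV[R]_n => x ord0 i) @^-1` ball (ratr (qk.1 i) : R) qk.2.+1%:R^-1)).
    apply: bigsetI_measurable => i _; rewrite -[X in measurable X]setTI.
    by apply: measurable_coord => //; exact: measurable_ball.
  apply/seteqP; split=> [x Bx|x].
    by apply: (@big_ind _ (fun S : set 'rV[R]_n => S x)) => // i _; exact: Bx.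
  by move=> + i; rewrite (bigD1 i)//= => -[].
rewrite (_ : A = \bigcup_(qk in [set: {ffun 'I_n -> rat} * nat])
    (if `[< box qk `<=` A >] then box qk else set0)).
  apply: countable_bigcupT_measurable => // qk.
  by case: ifP.
apply/seteqP; split=> [x Ax|x [qk _]]; last by case: ifPn => // /asboolP; exact.
have /nbhs_ballP[e /= e0 eA] : nbhs x A by exact: open_nbhs_nbhs.
have [k ke] : exists k, k.+1%:R^-1 < e / 2.
  have [k _ /(_ k (leqnn k)) ke] :=
    near_infty_natSinv_lt (PosNum (divr_gt0 e0 (ltr0Sn R 1))).
  by exists k.
have /choice[q qP] i : exists q : rat, `|ratr q - x ord0 i| < k.+1%:R^-1.
  have k0 : x ord0 i < x ord0 i + k.+1%:R^-1 by rewrite ltrDl.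
  have [q] := rat_in_itvoo k0; rewrite in_itv/= => /andP[xq qx]; exists q.
  by rewrite gtr0_norm ?subr_gt0// ltrBlDl.
pose qk : {ffun 'I_n -> rat} * nat := ([ffun i => q i], k).
exists qk => //=.
case: ifPn => [_ i|/negP]; first by rewrite /qk/= ffunE.
case; apply/asboolP => y yq; apply: eA; split=> // j i.
rewrite ord1 /ball/=; have := yq i; have := qP i; rewrite /qk/= ffunE.
move=> h1 h2.
rewrite -(subrKA (ratr (q i))) (le_lt_trans (ler_normD _ _))//.
by rewrite (splitr e) ltrD// (lt_trans _ ke)// distrC.
Qed.

Lemma continuous_measurable_rV (f : 'rV[R]_n -> R) :
  continuous f -> measurable_fun setT f.
Proof.
move=> /continuousP cf; apply: (measurability (@RGenOpens.G R)) => //.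
  exact: RGenOpens.measurableE.
by move=> _ [_ [a [b ->] <-]]; rewrite setTI; apply: open_measurable_rV; exact/cf/interval_open.
Qed.

Context {d} {T : measurableType d}.
Implicit Types u v : T -> 'rV[R]_n.

Lemma measurable_funD_rV u v : measurable_fun setT u -> measurable_fun setT v ->
  measurable_fun setT (fun t => u t + v t).
Proof.
move=> mu mv; apply: measurable_fun_rV => i; under eq_fun do rewrite mxE.
by apply: measurable_funD; exact: (measurableT_comp (measurable_coord i)).
Qed.

Lemma measurable_funZ_rV (a : T -> R) u : measurable_fun setT a ->
  measurable_fun setT u -> measurable_fun setT (fun t => a t *: u t).
Proof.
move=> ma mu; apply: measurable_fun_rV => i; under eq_fun do rewrite mxE.
by apply: measurable_funM => //; exact: (measurableT_comp (measurable_coord i)).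
Qed.

Lemma measurable_enorm : measurable_fun setT (@enorm R n).
Proof.
apply: measurableT_comp; first by apply: continuous_measurable_fun; exact: sqrt_continuous.
apply: measurable_sum => i; apply: measurable_funX; exact: measurable_coord.
Qed.

End measurable_rV.

Section affine_change_of_variables.
Context {R : realType}.
Local Open Scope ereal_scope.

(** Lebesgue measure is determined by the lengths of half-open intervals, and the
    image of Lebesgue measure under [x |-> a + c x], multiplied by [c], gives
    them the right length. *)
Lemma ge0_integral_lebesgue_affine (a c : R) (g : measurableTypeR R -> \bar R) :
  (0 < c)%R -> measurable_fun setT g -> (forall x, 0 <= g x) ->
  \int[lebesgue_measure]_x g (a + c * x)%R =
  (c^-1)%:E * \int[lebesgue_measure]_x g x.
Proof.
move=> c0 mg g0; pose phi (x : measurableTypeR R) : measurableTypeR R := (a + c * x)%R.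
have mphi : measurable_fun setT phi.
  by apply: measurable_funD => //; exact: measurable_funM.
have c_ge0 : (0 <= c^-1)%R by rewrite invr_ge0 ltW.
pose nu0 := mscale (NngNum (ltW c0)) (pushforward lebesgue_measure phi).
pose nu : {measure set (measurableTypeR R) -> \bar R} := nu0 mphi.
have nuE A : measurable A -> lebesgue_measure A = nu A.
  apply: lebesgue_measure_unique => _ [[u v]] _ <-.
  rewrite /nu /nu0/= /mscale/= /pushforward.
  rewrite (_ : phi @^-1` _ = `]((u - a) / c)%R, ((v - a) / c)%R]%classic); last first.
    apply/seteqP; split => x /=; rewrite !in_itv/= /phi;
      by rewrite ltr_pdivrMr// ler_pdivlMr// ltrBlDl lerBrDl mulrC.
  rewrite !lebesgue_measure_itv/= !lte_fin ltr_pM2r ?invr_gt0// ltrD2r.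
  case: ifPn => uv; last by rewrite mule0.
  rewrite -!EFinB -EFinM; congr EFin; field.
  by rewrite gt_eqF.
have -> : \int[lebesgue_measure]_x g x = \int[nu]_x g x.
  by apply: eq_measure_integral => A mA _; exact: nuE.
rewrite ge0_integral_mscale// ge0_integral_pushforward//= muleA -EFinM.
by rewrite mulVf ?gt_eqF// mul1e preimage_setT.
Qed.

Lemma ge0_integral_rV_cons n (g : 'rV[R]_n.+1 -> \bar R) :
  measurable_fun setT g -> (forall x, 0 <= g x) ->
  \int[lebesgue_rV n.+1]_x g x =
  \int[lebesgue_measure]_s \int[lebesgue_rV n]_x g (rV_cons (s, x)).
Proof.
move=> mg g0 /=.
rewrite (ge0_integral_pushforward (@measurable_rV_cons R n))//.
rewrite preimage_setT fubini_tonelli1//; last by move=> z; exact: g0.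
by apply: measurableT_comp => //; exact: measurable_rV_cons.
Qed.

Lemma ge0_integral_rV_affine n (a : 'rV[R]_n) (c : R) (g : 'rV[R]_n -> \bar R) :
  (0 < c)%R -> measurable_fun setT g -> (forall x, 0 <= g x) ->
  \int[lebesgue_rV n]_x g (a + c *: x)%R =
  (c ^- n)%:E * \int[lebesgue_rV n]_x g x.
Proof.
move=> c0; elim: n => [|n IHn] in a g *; move=> mg g0.
  rewrite expr0 invr1 mul1e; apply: eq_integral => x _; congr g.
  by apply/rowP => -[].
have mga : measurable_fun setT (fun x : 'rV[R]_n.+1 => g (a + c *: x)%R).
  apply: measurableT_comp => //; apply: measurable_funD_rV => //.
  exact: measurable_funZ_rV.
rewrite !ge0_integral_rV_cons//.
pose a0 := a ord0 ord0; pose a1 : 'rV[R]_n := (\row_i a ord0 (lift ord0 i))%R.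
have consE s x : (a + c *: rV_cons (s, x))%R = rV_cons ((a0 + c * s)%R, (a1 + c *: x)%R).
  apply/rowP => i; have [j ->|->] := unliftP ord0 i;
    rewrite [LHS]mxE [X in (_ + X)%R = _]mxE.
    by rewrite !rV_consS/= !mxE.
  by rewrite !rV_cons0.
have mg' (s : R) : measurable_fun setT (fun x => g (rV_cons (s, x))).
  apply: measurableT_comp => //; apply: (measurableT_comp (@measurable_rV_cons R n)).
  exact: measurable_pair1.
pose G (s : measurableTypeR R) := \int[lebesgue_rV n]_x g (rV_cons (s, x)).
have G0 s : 0 <= G s by apply: integral_ge0.
have mG : measurable_fun setT G.
  apply: (@measurable_fun_fubini_tonelli_F _ _ _ _ _ _ (g \o (@rV_cons R n))) => [|z]; last exact: g0.
  by apply: measurableT_comp => //; exact: measurable_rV_cons.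
transitivity (\int[lebesgue_measure]_s ((c ^- n)%:E * G (a0 + c * s)%R)).
  apply: eq_integral => s _; rewrite /G -(IHn a1)//.
  by apply: eq_integral => x _; rewrite consE.
rewrite -[X in _ = _ * X]/(\int[lebesgue_measure]_s G s).
move: G G0 mG => G G0 mG.
have maff : measurable_fun setT
    (fun s : measurableTypeR R => (a0 + c * s)%R : measurableTypeR R).
  by apply: measurable_funD => //; exact: measurable_funM.
rewrite (@ge0_integralZl_EFin _ _ _ _ setT _ (fun s : measurableTypeR R => G (a0 + c * s)%R))//; last 2 first.
- exact: (measurableT_comp mG maff).
- by rewrite invr_ge0 exprn_ge0// ltW.
rewrite (ge0_integral_lebesgue_affine a0 c0 mG)//.
by rewrite muleA -EFinM -invfM exprSr.
Qed.

Lemma ge0_integral_rV_translate n (a : 'rV[R]_n) (g : 'rV[R]_n -> \bar R) :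
  measurable_fun setT g -> (forall x, 0 <= g x) ->
  \int[lebesgue_rV n]_x g (a + x)%R = \int[lebesgue_rV n]_x g x.
Proof.
move=> mg g0; have := ge0_integral_rV_affine a ltr01 mg g0.
have -> : (1 ^- n)%:E = 1 :> \bar R by rewrite expr1n invr1.
rewrite mul1e => <-.
by apply: eq_integral => x _; rewrite scale1r.
Qed.

End affine_change_of_variables.

(** * Integration against a density *)

Section density.
Context d (T : measurableType d) (R : realType).
Local Open Scope ereal_scope.

(** By uniqueness [r] agrees almost everywhere with the Radon-Nikodym
    derivative of [mu], for which the change of variables is known. *)
Lemma ge0_integral_density (nu : {sigma_finite_measure set T -> \bar R})
    (mu : {finite_measure set T -> \bar R}) (r : T -> R) (g : T -> \bar R) :
  measurable_fun setT r -> (forall x, 0 <= r x)%R ->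
  (forall A, measurable A -> mu A = \int[nu]_(x in A) (r x)%:E) ->
  measurable_fun setT g -> (forall x, 0 <= g x) ->
  \int[mu]_x g x = \int[nu]_x (g x * (r x)%:E).
Proof.
move=> mr r0 muE mg g0.
have munu : mu `<< nu.
  apply/null_content_dominatesP => A mA A0; rewrite muE//.
  by apply: null_set_integral => //; exact/measurable_EFinP/measurable_funTS.
rewrite -(Radon_Nikodym_SigmaFinite.change_of_variables munu g0 measurableT mg).
have RNi := Radon_Nikodym_SigmaFinite.f_integrable munu.
have RN0 := Radon_Nikodym_SigmaFinite.f_ge0 munu.
apply: ge0_ae_eq_integral => //.
- by apply: emeasurable_funM => //; exact: measurable_int RNi.
- by apply: emeasurable_funM => //; exact/measurable_EFinP.
- by move=> x _; rewrite mule_ge0.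
- by move=> x _; rewrite mule_ge0// lee_fin.
have : ae_eq nu setT (Radon_Nikodym_SigmaFinite.f mu nu) (EFin \o r).
  apply: integral_ae_eq => //; first exact/measurable_EFinP.
  move=> A _ mA; rewrite -Radon_Nikodym_SigmaFinite.f_integral//.
  exact: muE.
by apply: filterS => x /= h _; rewrite h.
Qed.

End density.

(** * The interpolation inequality *)

Section log_concave.
Context {R : realType} {n : nat}.
Variable f : 'rV[R]_n -> R.
Hypothesis convex_f : forall x y (t : R), 0 <= t <= 1 ->
  f ((1 - t) *: x + t *: y) <= (1 - t) * f x + t * f y.
Let rho x := expR (- f x).

Lemma expR_convex_comb (t a b : R) : 0 <= t <= 1 ->
  expR (t * a + (1 - t) * b) <= t * expR a + (1 - t) * expR b.
Proof.
move=> /andP[t0 t1].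
have := @convex_expR R (Itv01 t0 t1) a b; rewrite !convRE/=.
exact.
Qed.

(** Jensen's inequality: the bound is [t * t^-1 + (1 - t) * (1 - t)^-1]. *)
Lemma expR_entropy_le2 (t : R) : 0 < t < 1 ->
  expR (t * - ln t + (1 - t) * - ln (1 - t)) <= 2.
Proof.
move=> /andP[t0 t1]; have t'0 : 0 < 1 - t by rewrite subr_gt0.
rewrite (le_trans (expR_convex_comb _ _ _)) ?(ltW t0) ?(ltW t1)//.
by rewrite !expRN !lnK ?posrE// !mulfV ?gt_eqF.
Qed.

(** Convexity of [f] bounds [rho x * rho y] by [rho z] times
    [rho x ^ t * rho y ^ (1 - t)].  Before the arithmetic-geometric mean
    inequality is applied to the latter, the factors [t ^ n] and
    [(1 - t) ^ n] are inserted, because they are the Jacobians of [y |-> z] and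
    [x |-> z]; they will cancel under the integral. *)
Lemma log_concave_pair (x y : 'rV[R]_n) (t : R) : 0 < t < 1 ->
  rho x * rho y <= rho ((1 - t) *: x + t *: y) *
    (2 ^+ n * (t ^+ n.+1 * rho x + (1 - t) ^+ n.+1 * rho y)).
Proof.
move=> t01; have /andP[t0 t1] := t01; have t'0 : 0 < 1 - t by rewrite subr_gt0.
have t01' : 0 <= t <= 1 by rewrite !ltW.
rewrite /rho -expRD.
apply: (@le_trans _ _ (expR (- f ((1 - t) *: x + t *: y)) *
    expR (t * - f x + (1 - t) * - f y))).
  (* the exponents add up to [- f x - f y] *)
  by rewrite -expRD ler_expR; have := convex_f x y t01'; lra.
rewrite ler_wpM2l ?expR_ge0//.
pose s := t * - ln t + (1 - t) * - ln (1 - t).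
have -> : t * - f x + (1 - t) * - f y = n%:R * s +
    (t * (n%:R * ln t - f x) + (1 - t) * (n%:R * ln (1 - t) - f y)).
  by rewrite /s; ring.
rewrite expRD expRM_natl ler_pM ?expR_ge0 ?exprn_ge0 ?expR_ge0//.
  by apply: lerXn2r; rewrite ?nnegrE ?expR_ge0// expR_entropy_le2.
rewrite (le_trans (expR_convex_comb _ _ t01'))//.
by rewrite !expRD !expRM_natl !lnK ?posrE// !mulrA -!exprS.
Qed.

End log_concave.

Section interpolation.
Context {R : realType} {n : nat}.
Variable f : 'rV[R]_n -> R.
Hypothesis continuous_f : continuous f.
Hypothesis convex_f : forall x y (t : R), (0 <= t <= 1)%R ->
  (f ((1 - t) *: x + t *: y) <= (1 - t) * f x + t * f y)%R.
Let rho x := expR (- f x).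
Variable mu : probability 'rV[R]_n R.
Local Open Scope ereal_scope.
Hypothesis mu_density : forall A : set 'rV[R]_n, measurable A ->
  mu A = \int[lebesgue_rV n]_(x in A) (rho x)%:E.

Let L := @lebesgue_rV R n.

Lemma measurable_density : measurable_fun setT rho.
Proof.
apply: continuous_measurable_rV => x.
apply: continuous_comp; last exact: continuous_expR.
by apply: continuousN; exact: continuous_f.
Qed.

Let mrho : measurable_fun setT (EFin \o rho).
Proof. by apply/measurable_EFinP; exact: measurable_density. Qed.

Let rho0 x : 0 <= (rho x)%:E. Proof. by rewrite lee_fin expR_ge0. Qed.

Lemma integral_density1 : \int[L]_x (rho x)%:E = 1.
Proof. by rewrite -(mu_density measurableT); exact: probability_setT. Qed.

Lemma measurable_segment (t : R) : measurable_fun setT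
  (fun p : 'rV[R]_n * 'rV[R]_n => (1 - t) *: p.1 + t *: p.2)%R.
Proof.
by apply: measurable_funD_rV; apply: measurable_funZ_rV.
Qed.

Let integral_mu (g : 'rV[R]_n -> \bar R) : measurable_fun setT g ->
  (forall x, 0 <= g x) -> \int[mu]_x g x = \int[L]_x (g x * (rho x)%:E).
Proof.
move=> mg g0; apply: ge0_integral_density => //; exact: measurable_density.
Qed.

(** The inner integral is a rescaling of that of [g], whatever [x] is, so
    [rho x] integrates to 1 independently. *)
Let double_integral (g : 'rV[R]_n -> \bar R) (a b : R) :
  (0 < b)%R -> measurable_fun setT g -> (forall x, 0 <= g x) ->
  \int[L]_x \int[L]_y ((rho x)%:E * g (a *: x + b *: y)%R) =
  (b ^- n)%:E * \int[L]_x g x.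
Proof.
move=> b0 mg g0.
transitivity (\int[L]_x ((rho x)%:E * ((b ^- n)%:E * \int[L]_y g y))).
  apply: eq_integral => x _; rewrite ge0_integralZl_EFin ?expR_ge0//.
    by rewrite (ge0_integral_rV_affine _ b0 mg g0).
  apply: measurableT_comp => //; apply: measurable_funD_rV => //.
  exact: measurable_funZ_rV.
rewrite ge0_integralZr//; last first.
  by rewrite mule_ge0 ?integral_ge0// lee_fin invr_ge0 exprn_ge0// ltW.
by rewrite integral_density1 mul1e.
Qed.

(** The integrals [I1] and [I2] of the two terms of [log_concave_pair] carry
    the Jacobians [t ^- n] and [(1 - t) ^- n]; against the weights
    [t ^ (n+1)] and [(1 - t) ^ (n+1)] there remains [t + (1 - t) = 1]. *)
Lemma interpolation_le (t : R) (g : 'rV[R]_n -> \bar R) : (0 < t < 1)%R ->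
  measurable_fun setT g -> (forall x, 0 <= g x) ->
  \int[mu]_x \int[mu]_y g ((1 - t) *: x + t *: y)%R <=
  (2 ^+ n)%:E * \int[mu]_x g x.
Proof.
move=> t01 mg g0; have /andP[t0 t1] := t01; have t'0 : (0 < 1 - t)%R by rewrite subr_gt0.
pose z (p : 'rV[R]_n * 'rV[R]_n) := ((1 - t) *: p.1 + t *: p.2)%R.
have mz : measurable_fun setT z := measurable_segment t.
pose grho x := g x * (rho x)%:E.
have grho0 x : 0 <= grho x by rewrite mule_ge0.
have mgrho : measurable_fun setT grho by exact: emeasurable_funM.
have mrho1 : measurable_fun setT (fun p : 'rV[R]_n * 'rV[R]_n => (rho p.1)%:E).
  exact: (measurableT_comp mrho measurable_fst).
have mrho2 : measurable_fun setT (fun p : 'rV[R]_n * 'rV[R]_n => (rho p.2)%:E).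
  exact: (measurableT_comp mrho measurable_snd).
pose F1 p := (rho p.1)%:E * grho (z p).
pose F2 p := (rho p.2)%:E * grho (z p).
have mF1 : measurable_fun setT F1.
  by apply: emeasurable_funM => //; exact: measurableT_comp.
have mF2 : measurable_fun setT F2.
  by apply: emeasurable_funM => //; exact: measurableT_comp.
have F10 p : 0 <= F1 p by rewrite mule_ge0.
have F20 p : 0 <= F2 p by rewrite mule_ge0.
pose c1 := (2 ^+ n * t ^+ n.+1)%R; pose c2 := (2 ^+ n * (1 - t) ^+ n.+1)%R.
have c10 : (0 <= c1)%R by rewrite mulr_ge0 ?exprn_ge0// ltW.
have c20 : (0 <= c2)%R by rewrite mulr_ge0 ?exprn_ge0// ltW.
have mgz : measurable_fun setT (fun p => g (z p)) by exact: measurableT_comp.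
have -> : \int[mu]_x \int[mu]_y g (z (x, y)) =
    \int[L \x L]_p (g (z p) * (rho p.1)%:E * (rho p.2)%:E).
  rewrite fubini_tonelli1/=; last 2 first.
  - by apply: emeasurable_funM => //; exact: emeasurable_funM.
  - by move=> p; rewrite !mule_ge0.
  rewrite integral_mu; last 2 first.
  - exact: (measurable_fun_fubini_tonelli_F (fun p => g (z p))).
  - by move=> x; exact: integral_ge0.
  apply: eq_integral => x _.
  rewrite integral_mu//; last by apply: (measurableT_comp mgz); exact: measurable_pair1.
  pose G y := g (z (x, y)) * (rho y)%:E.
  have G0 y : 0 <= G y by rewrite mule_ge0.
  have mG : measurable_fun setT G.
    apply: emeasurable_funM => //.
    by apply: (measurableT_comp mgz); exact: measurable_pair1.
  transitivity (\int[L]_y ((rho x)%:E * G y)).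
    by rewrite muleC (@ge0_integralZl_EFin _ _ _ L setT measurableT G) ?expR_ge0.
  by apply: eq_integral => y _; rewrite /G /= muleCA muleA.
have I1 : \int[L \x L]_p F1 p = (t ^- n)%:E * \int[mu]_x g x.
  by rewrite fubini_tonelli1// (integral_mu mg g0) -(double_integral (1 - t)%R t0 mgrho grho0).
have I2 : \int[L \x L]_p F2 p = ((1 - t) ^- n)%:E * \int[mu]_x g x.
  rewrite fubini_tonelli2// (integral_mu mg g0) -(double_integral t t'0 mgrho grho0).
  apply: eq_integral => y _; apply: eq_integral => x _ /=.
  by rewrite /F2 /z /= addrC.
apply: (@le_trans _ _ (\int[L \x L]_p (c1%:E * F1 p + c2%:E * F2 p))).
  apply: ge0_le_integral => //.
  - by move=> p _; rewrite !mule_ge0.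
  - by apply: emeasurable_funM => //; exact: emeasurable_funM.
  - by apply: emeasurable_funD; exact: measurable_funeM.
  move=> p _; rewrite /F1 /F2 /grho.
  rewrite !muleA -!EFinM ![_ * g _]muleC -!muleA -!EFinM -ge0_muleDr ?lee_fin ?mulr_ge0 ?expR_ge0 ?exprn_ge0 ?(ltW t0) ?(ltW t'0)//.
  rewrite lee_wpmul2l// -EFinD lee_fin.
  have := log_concave_pair convex_f p.1 p.2 t01; rewrite /c1 /c2 -/(z p) /rho; lra.
have D0 (c : R) F : (0 <= c)%R -> (forall p, 0 <= F p) ->
    forall p, [set: 'rV[R]_n * 'rV[R]_n] p -> 0 <= c%:E * F p.
  by move=> hc F0 q _; rewrite mule_ge0.
have -> : \int[L \x L]_p (c1%:E * F1 p + c2%:E * F2 p) =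
    \int[L \x L]_p (c1%:E * F1 p) + \int[L \x L]_p (c2%:E * F2 p).
  exact: (ge0_integralD _ measurableT (D0 _ _ c10 F10)
    (measurable_funeM _ mF1) (D0 _ _ c20 F20) (measurable_funeM _ mF2)).
rewrite (ge0_integralZl_EFin (L \x L) measurableT (fun p _ => F10 p) mF1 c10).
rewrite (ge0_integralZl_EFin (L \x L) measurableT (fun p _ => F20 p) mF2 c20).
rewrite I1 I2 !muleA -!EFinM -ge0_muleDl ?lee_fin; last 2 first.
- by rewrite divr_ge0 ?exprn_ge0// ltW.
- by rewrite divr_ge0 ?exprn_ge0// ltW.
rewrite -EFinD (_ : c1 / t ^+ n + c2 / (1 - t) ^+ n = 2 ^+ n)%R//.
rewrite /c1 /c2 !exprSr; field.
by rewrite !gt_eqF ?exprn_gt0.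
Qed.

End interpolation.

(** * Almost everywhere differentiability of Lipschitz functions *)

Section lipschitz_ae_derivable.
Context {R : realType}.
Notation leb := (@lebesgue_measure R).

(** The Stieltjes measures of [g] and [g'] add up to Lebesgue measure, so
    the measure of [g] is absolutely continuous; [g] is then locally the
    integral of its Radon-Nikodym density, hence derivable almost everywhere
    by Lebesgue's differentiation theorem. *)
Lemma complementary_nondecreasing_ae_derivable (g g' : R -> R) :
  nondecreasing g -> nondecreasing g' -> continuous g -> continuous g' ->
  (forall x, g x + g' x = x) ->
  {ae leb, forall x, derivable g x 1}.
Proof.
move=> ndg ndg' cg cg' gg'.
have rc (k : R -> R) : continuous k -> right_continuous k.
  by move=> ck x; apply: cvg_at_right_filter; exact: ck.
pose G : cumulative R R := HB.pack g (isCumulative.Build _ _ _ g ndg (rc _ cg)).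
pose G' : cumulative R R := HB.pack g' (isCumulative.Build _ _ _ g' ndg' (rc _ cg')).
pose nu := lebesgue_stieltjes_measure G.
pose nu' := lebesgue_stieltjes_measure G'.
have nu_itv (k : cumulative R R) (a b : R) : a <= b ->
    lebesgue_stieltjes_measure k `]a, b] = (k b - k a)%:E.
  move=> ab; rewrite /lebesgue_stieltjes_measure /measure_extension measurable_mu_extE/=.
    by rewrite wlength_itv_bnd.
  exact: is_ocitv.
have lebE A : measurable A -> leb A = (nu A + nu' A)%E.
  move=> mA; rewrite -[RHS](measure_addE nu nu'); move: A mA.
  apply: lebesgue_measure_unique => _ [[a b]] _ <-; rewrite [fst _]/= [snd _]/=.
  transitivity (nu `]a, b]%classic + nu' `]a, b]%classic)%E; last exact/esym/(measure_addE nu nu').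
  have [ab|ba] := leP a b; last first.
    by rewrite set_itv_ge ?bnd_simp -?leNgt ?(ltW ba)// /nu /nu' !measure0 adde0.
  rewrite /nu /nu' !nu_itv// /lebesgue_measure nu_itv//= -EFinD; congr EFin.
  by rewrite -[in LHS](gg' b) -[in LHS](gg' a); ring.
have dg (N : nat) : {ae leb, forall x, - N%:R < x < N%:R -> derivable g x 1}.
  pose D := `](- N%:R : R), N%:R]%classic.
  have mD : measurable (D : set (measurableTypeR R)) by exact: measurable_itv.
  have nuD : (nu D < +oo)%E.
    by rewrite /nu nu_itv ?ltry// (le_trans _ (ler0n R N))// oppr_le0.
  pose nuN : {finite_measure set (measurableTypeR R) -> \bar R} := mfrestr mD nuD.
  have nuNleb : nuN `<< leb.
    apply/null_content_dominatesP => A mA A0.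
    apply/eqP; rewrite eq_le measure_ge0 andbT.
    have nuNle : (nuN A <= nu A)%E.
      by rewrite /nuN/= /mfrestr /mrestr le_measure// inE//; exact: measurableI.
    rewrite (le_trans nuNle)//.
    suff : (nu A <= leb A)%E by rewrite A0.
    by rewrite (lebE _ mA) leeDl// measure_ge0.
  have ri := Radon_Nikodym_SigmaFinite.f_integrable nuNleb.
  have rfin := Radon_Nikodym_SigmaFinite.f_fin_num nuNleb.
  have rE := Radon_Nikodym_SigmaFinite.f_integral nuNleb.
  set r := Radon_Nikodym_SigmaFinite.f nuN leb in ri rfin rE.
  have frE : EFin \o (fine \o r) = r by apply/funext => x /=; rewrite fineK.
  pose F (y : R) : R := Rintegral leb [set` `]-oo, y]] (fine \o r).
  have : {ae leb, forall x, derivable F x 1 /\ (F^`())%classic x = (fine \o r) x}.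
    apply: FTC1Ny => [y|].
      by rewrite frE; apply: (integrableS measurableT).
    by apply: open_integrable_locally; [exact: openT|rewrite frE].
  apply: filterS; first exact: (ae_filter_ringOfSetsType leb).
  move=> x [dx _] /andP[Nx xN].
  suff : derivable (fun y => g y - g (- N%:R)) x 1.
    move=> /(derivableD)/(_ (derivable_cst (g (- N%:R)) x 1)).
    by apply: near_eq_derivable; near=> y => /=; rewrite /cst/= subrK.
  apply: near_eq_derivable dx; near=> y.
  have Ny : - N%:R < y by near: y; exact: lt_nbhsr.
  have yN : y < N%:R by near: y; exact: lt_nbhsl.
  have -> : F y = fine (nuN `]-oo, y]%classic).
    rewrite rE// /F /Rintegral; congr fine; apply: eq_integral => t _.
    by rewrite -[in RHS]frE.
  rewrite /nuN/= /mfrestr /mrestr (_ : _ `&` _ = `](- N%:R), y]%classic).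
    by rewrite /nu nu_itv//= ltW.
  apply/seteqP; rewrite /D; split => z /=; rewrite !in_itv/=.
    by move=> [zy /andP[-> _]].
  by move=> /andP[-> zy]; rewrite zy (le_trans zy)// ltW.
have := ae_foralln dg.
apply: filterS => x h.
by apply: (h (Num.bound `|x|)); rewrite -ltr_norml archi_boundP.
Unshelve. all: by end_near. Qed.

(** The functions [x + phi x / k] and [x - phi x / k] are nondecreasing and
    their halves add up to the identity. *)
Lemma lipschitz_ae_derivable (phi : R -> R) (k : R) : 0 < k ->
  (forall x y, `|phi x - phi y| <= k * `|x - y|) ->
  {ae leb, forall x, derivable phi x 1}.
Proof.
move=> k0 lphi.
have cphi : continuous phi.
  move=> x; apply/cvgrPdist_le => e e0; near=> y.
  rewrite (le_trans (lphi _ _))// mulrC -ler_pdivlMr//.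
  by near: y; apply: cvgr_dist_le; [exact: cvg_id|exact: divr_gt0].
have lphik x y : x <= y -> `|k^-1 * phi y - k^-1 * phi x| <= y - x.
  move=> xy; rewrite -mulrBr normrM gtr0_norm ?invr_gt0// ler_pdivrMl//.
  by rewrite (le_trans (lphi _ _))// ger0_norm ?subr_ge0.
pose g x := (x + k^-1 * phi x) / 2; pose g' x := (x - k^-1 * phi x) / 2.
have ck : continuous (fun x => k^-1 * phi x).
  by move=> x; apply: cvgMl_tmp; exact: cphi.
have : {ae leb, forall x, derivable g x 1}.
  apply: (@complementary_nondecreasing_ae_derivable g g').
  - by move=> x y xy; rewrite ler_pM2r//; have := lphik _ _ xy; rewrite ler_norml; lra.
  - by move=> x y xy; rewrite ler_pM2r//; have := lphik _ _ xy; rewrite ler_norml; lra.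
  - by move=> x; apply: cvgMr_tmp; apply: cvgD; [exact: cvg_id|exact: ck].
  - by move=> x; apply: cvgMr_tmp; apply: cvgB; [exact: cvg_id|exact: ck].
  - by move=> x; rewrite /g /g'; move: (k^-1 * phi x) => c; field.
apply: filterS; first exact: (ae_filter_ringOfSetsType leb).
move=> x dg.
have -> : phi = (k * 2) \*: g - k \*: id.
  apply/funext => y; transitivity (k * 2 * g y - k * y); last by [].
  rewrite /g; field.
  by rewrite gt_eqF.
apply: derivableB; first exact: (@derivableZ _ _ _ g).
exact: (@derivableZ _ _ _ id).
Unshelve. all: by end_near. Qed.

End lipschitz_ae_derivable.

Lemma ae0_integral d (T : measurableType d) (R : realType)
    (mu : {measure set T -> \bar R}) (f : T -> \bar R) :
  measurable_fun setT f -> {ae mu, forall x, f x = 0%E} ->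
  (\int[mu]_x f x = 0)%E.
Proof.
move=> mf f0; transitivity (\int[mu]_x cst 0 x)%E; last exact: integral0.
apply: ae_eq_integral => //.
by apply: filterS f0 => x ->.
Qed.

Section difference_quotient.
Context {R : realType} {V : normedModType R}.
Implicit Types (a v x : V) (h : V -> R).

Lemma continuous_addl a : continuous (fun x => a + x).
Proof. by move=> x; apply: cvgD; [exact: cvg_cst|exact: cvg_id]. Qed.

Definition difference_quotient h v (t : R) x := t^-1 * (h (t *: v + x) - h x).

Lemma continuous_difference_quotient h v t :
  continuous h -> continuous (difference_quotient h v t).
Proof.
move=> ch x; apply: cvgMl_tmp; apply: cvgB; last exact: ch.
by apply: continuous_comp; [exact: continuous_addl|exact: ch].
Qed.

Lemma open_difference_quotient_gap h v p q (e : R) : continuous h ->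
  open [set x | e < `|difference_quotient h v p x - difference_quotient h v q x|].
Proof.
move=> ch; pose g x := `|difference_quotient h v p x - difference_quotient h v q x|.
have cg : continuous g.
  by move=> x; apply: cvg_norm; apply: cvgB; exact: continuous_difference_quotient.
apply: (open_comp (f := g) (D := [set r | e < r])); last exact: open_gt.
by move=> x _; exact: cg.
Qed.

Lemma lipschitz_near_continuous h k : 0 < k ->
  (forall x a, `|a| <= 1 -> `|h (a + x) - h x| <= k * `|a|) -> continuous h.
Proof.
move=> k0 lh x; apply/cvgrPdist_le => e e0; near=> y.
have yx : `|y - x| <= 1.
  by rewrite distrC; near: y; apply: cvgr_dist_le; [exact: cvg_id|].
have := lh x _ yx; rewrite subrK distrC => /le_trans; apply.
rewrite mulrC -ler_pdivlMr// distrC.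
by near: y; apply: cvgr_dist_le; [exact: cvg_id|exact: divr_gt0].
Unshelve. all: by end_near. Qed.

Lemma lipschitz_continuous h k : 0 < k ->
  (forall x y, `|h x - h y| <= k * `|x - y|) -> continuous h.
Proof.
move=> k0 lh; apply: (lipschitz_near_continuous k0) => x a _.
by rewrite (le_trans (lh _ _))// addrK.
Qed.

End difference_quotient.

Section directional_derivative_measurable.
Context {R : realType} {n : nat}.
Variable h : 'rV[R]_n -> R.
Hypothesis continuous_h : continuous h.
Variable v : 'rV[R]_n.

Let Q := difference_quotient h v.

(** The points where the difference quotient along [v] still oscillates by more
    than [1 / (m + 1)] on the scale [1 / (k + 1)]. *)
Let oscillation (m k : nat) : set 'rV[R]_n :=
  [set x | exists p q, [/\ 0 < `|p| < k.+1%:R^-1, 0 < `|q| < k.+1%:R^-1 &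
    m.+1%:R^-1 < `|Q p x - Q q x|]].

Let open_oscillation m k : open (oscillation m k).
Proof.
rewrite (_ : oscillation m k = \bigcup_(pq in
    [set pq : R * R | 0 < `|pq.1| < k.+1%:R^-1 /\ 0 < `|pq.2| < k.+1%:R^-1])
    [set x | m.+1%:R^-1 < `|Q pq.1 x - Q pq.2 x|]).
  by apply: bigcup_open => pq _; exact: open_difference_quotient_gap.
apply/seteqP; split => [x [p [q [hp hq pq]]]|x [[p q] [hp hq] pq]].
  by exists (p, q).
by exists p, q.
Qed.

(** Cauchy's criterion for the difference quotients; since the oscillation
    sets are open, it shows that the derivability set is Borel. *)
Lemma derivable_setE :
  [set x | derivable h x v] = \bigcap_m \bigcup_k ~` oscillation m k.
Proof.
have QE x : (fun t => t^-1 *: (h (t *: v + x) - h x)) = Q ^~ x by [].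
apply/seteqP; split => x /=.
  move=> /cvg_ex[/= l]; rewrite QE => Ql m _.
  have e0 : 0 < m.+1%:R^-1 / 2 :> R by rewrite divr_gt0.
  have /cvgrPdist_lt/(_ _ e0)[d /= d0 dQ] := Ql.
  have [k _ /(_ k (leqnn k)) kd] := near_infty_natSinv_lt (PosNum d0).
  have Qk p : 0 < `|p| < k.+1%:R^-1 -> `|l - Q p x| < m.+1%:R^-1 / 2.
    move=> /andP[p0 pk]; apply: dQ => /=; last by rewrite -normr_gt0.
    by rewrite sub0r normrN (lt_trans pk).
  exists k => // -[p [q [/Qk hp /Qk hq]]]; apply/negP; rewrite -leNgt.
  rewrite -(subrKA l) (le_trans (ler_normD _ _))// (splitr (m.+1%:R^-1)).
  by rewrite lerD// ltW// distrC.
move=> hx; rewrite /derivable QE; apply/cauchy_cvgP/cauchy_exP => e e0.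
have [m _ /(_ m (leqnn m)) me] := near_infty_natSinv_lt (PosNum e0).
have [k _ hk] := hx m I.
exists (Q k.+2%:R^-1 x); exists k.+1%:R^-1 => //= p.
rewrite /= sub0r normrN => pk p0.
rewrite /ball/= (le_lt_trans _ me)// leNgt; apply/negP => pq.
apply: hk; exists k.+2%:R^-1, p; split => //.
  by rewrite gtr0_norm// ltf_pV2 ?posrE// ltr_nat; apply/andP; split.
by rewrite normr_gt0 p0.
Qed.

Lemma measurable_derivable : measurable [set x | derivable h x v].
Proof.
rewrite derivable_setE; apply: bigcapT_measurable => m.
apply: bigcupT_measurable => k; apply: measurableC.
exact: open_measurable_rV.
Qed.

Lemma measurable_derive : measurable_fun setT ('D_v h).
Proof.
have mE := measurable_derivable.
rewrite -(setUv [set x | derivable h x v]).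
apply/(measurable_funU _ mE (measurableC mE)); split; last first.
  (* where the limit does not exist the derivative is a default value *)
  apply: (eq_measurable_fun (cst point)); last exact: measurable_cst.
  by move=> x; rewrite inE/= => ndx; rewrite /derive dvgP.
apply: (@measurable_fun_cvg _ _ _ _ (fun k => Q k.+1%:R^-1)) => //.
  move=> k; apply: measurable_funTS; apply: continuous_measurable_rV.
  exact: continuous_difference_quotient.
move=> x /= dx.
have := dx; rewrite /derivable => /cvg_ex[l Ql].
rewrite /derive (cvg_lim _ Ql)//.
have /cvgr_dnbhsP := Ql; apply; split => [k|]; first exact: invr_neq0.
exact: cvg_harmonic.
Qed.

End directional_derivative_measurable.

Section directional_derivative_ae.
Context {R : realType} {n : nat}.
Variable h : 'rV[R]_n -> R.
Variable k : R.
Hypothesis k0 : 0 < k.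
Hypothesis lipschitz_h : forall x y, `|h x - h y| <= k * `|x - y|.

(** Let [N] be the set of points where [h] has no derivative along [v].  Every
    line parallel to [v] meets [N] in a null set, by the one-dimensional case.
    The translates of [N] by [s v] all have the measure of [N]; integrating
    this measure over all real [s] and exchanging integrals gives 0, which is
    impossible unless [N] is null. *)
Lemma ae_derivable (v : 'rV[R]_n) : v != 0 ->
  {ae lebesgue_rV n, forall x, derivable h x v}.
Proof.
move=> v0; pose N := ~` [set x | derivable h x v].
have mN : measurable N.
  by apply: measurableC; apply: measurable_derivable; exact: lipschitz_continuous k0 lipschitz_h.
suff N0 : lebesgue_rV n N = 0%E by exists N; split.
pose g (x : 'rV[R]_n) : \bar R := (\1_N x)%:E.
have mg : measurable_fun setT g by apply/measurable_EFinP; exact: measurable_indic.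
have g0 x : (0 <= g x)%E by rewrite lee_fin.
pose F (p : measurableTypeR R * 'rV[R]_n) := g (p.1 *: v + p.2).
have mF : measurable_fun setT F.
  apply: (measurableT_comp mg); apply: measurable_funD_rV => //.
  exact: measurable_funZ_rV.
have slice0 x : (\int[lebesgue_measure]_s F (s, x) = 0)%E.
  pose phi (s : R) := h (x + s *: v).
  have phi_ae : {ae lebesgue_measure, forall s, derivable phi s 1}.
    apply: (@lipschitz_ae_derivable _ _ (k * `|v|)); first by rewrite mulr_gt0 ?normr_gt0.
    move=> s t; rewrite (le_trans (lipschitz_h _ _))// opprD addrACA subrr add0r.
    by rewrite -scalerBl normrZ -mulrA [`|v| * _]mulrC.
  apply: ae0_integral.
    by apply: (measurableT_comp mF); exact: measurable_pair2.
  move: phi_ae; apply: filterS; first exact: (ae_filter_ringOfSetsType lebesgue_measure).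
  move=> s ds.
  have nN : ~ N (s *: v + x).
    apply; have /derivableP/(is_derive_line h x v s) [] := ds.
    by rewrite addrC.
  by rewrite /F /g/= indicE (memNset nN).
have Ns (s : R) : (lebesgue_rV n N = \int[lebesgue_rV n]_x F (s, x))%E.
  have -> : (lebesgue_rV n N = \int[lebesgue_rV n]_x g x)%E.
    by rewrite (integral_indic _ measurableT mN) setIT.
  exact/esym/(ge0_integral_rV_translate (s *: v) mg g0).
have : (\int[@lebesgue_measure R]_s lebesgue_rV n N = 0)%E.
  transitivity (\int[@lebesgue_measure R]_s \int[lebesgue_rV n]_x F (s, x))%E.
    by apply: eq_integral => s _; exact: Ns.
  transitivity (\int[lebesgue_rV n]_x \int[@lebesgue_measure R]_s F (s, x))%E.
    exact: (fubini_tonelli F mF (fun p => g0 _)).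
  transitivity (\int[@lebesgue_rV R n]_x cst 0%E x)%E; last exact: integral0.
  by apply: eq_integral => x _; exact: slice0.
rewrite integral_cst//= -set_itvNyy lebesgue_measure_itv/= => /eqP.
by rewrite mule_eq0/= orbF => /eqP.
Qed.

End directional_derivative_ae.

(** * Mollification by a tent function *)

Section weighted_integral.
Context d (T : measurableType d) (R : realType).
Variables (mu : {measure set T -> \bar R}) (K : T -> R).
Hypothesis K0 : forall w, 0 <= K w.
Hypothesis iK : mu.-integrable setT (EFin \o K).
Implicit Types g : T -> R.

(** The weight stays in the integrand, and not in the measure, so that
    translations of the Lebesgue integral can be used. *)
Definition weighted_integral g : R := \int[mu]_w (g w * K w).

Definition bounded_measurable g :=
  measurable_fun setT g /\ exists B, forall w, `|g w| <= B.

Let mK : measurable_fun setT K.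
Proof. exact/measurable_EFinP/(measurable_int mu). Qed.

Lemma integrable_weighted g : bounded_measurable g ->
  mu.-integrable setT (EFin \o (fun w => g w * K w)).
Proof.
move=> [mg [B gB]].
apply: (@integrableMr _ _ _ mu setT measurableT g (EFin \o K)) => //.
exists B; split; first exact: num_real.
by move=> M BM w _; rewrite /= (le_trans (gB w))// ltW.
Qed.

Lemma bounded_measurableD g g' : bounded_measurable g -> bounded_measurable g' ->
  bounded_measurable (fun w => g w + g' w).
Proof.
move=> [mg [B gB]] [mg' [B' gB']]; split; first exact: measurable_funD.
by exists (B + B') => w; rewrite (le_trans (ler_normD _ _))// lerD.
Qed.

Lemma bounded_measurableZ g c : bounded_measurable g ->
  bounded_measurable (fun w => c * g w).
Proof.
move=> [mg [B gB]]; split; first exact: measurable_funM.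
by exists (`|c| * B) => w; rewrite normrM ler_wpM2l.
Qed.

Lemma bounded_measurable_cst c : bounded_measurable (fun=> c).
Proof. by split; [exact: measurable_cst|exists `|c|]. Qed.

Lemma weighted_integralD g g' : bounded_measurable g -> bounded_measurable g' ->
  weighted_integral (fun w => g w + g' w) = weighted_integral g + weighted_integral g'.
Proof.
move=> bg bg'; rewrite /weighted_integral -RintegralD//; last 2 first.
- exact: integrable_weighted.
- exact: integrable_weighted.
by apply: eq_Rintegral => w _; rewrite mulrDl.
Qed.

Lemma weighted_integralZ g c : bounded_measurable g ->
  weighted_integral (fun w => c * g w) = c * weighted_integral g.
Proof.
move=> bg; rewrite /weighted_integral -RintegralZl//; last exact: integrable_weighted.
by apply: eq_Rintegral => w _; rewrite mulrA.
Qed.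

Lemma weighted_integral_sum n (c : 'I_n -> R) (g : 'I_n -> T -> R) :
  (forall i, bounded_measurable (g i)) ->
  bounded_measurable (fun w => \sum_i c i * g i w) /\
  weighted_integral (fun w => \sum_i c i * g i w) =
  \sum_i c i * weighted_integral (g i).
Proof.
move=> bg; elim: (index_enum _) => [|i s [bs IHs]].
  rewrite big_nil; under eq_fun do rewrite big_nil; split.
    exact: bounded_measurable_cst.
  rewrite /weighted_integral; under eq_Rintegral do rewrite mul0r.
  by rewrite /Rintegral integral0.
under eq_fun do rewrite big_cons.
have bi := bounded_measurableZ (c i) (bg i).
split; first exact: bounded_measurableD.
by rewrite big_cons weighted_integralD// weighted_integralZ// IHs.
Qed.

Lemma weighted_integral_normr g : bounded_measurable g ->
  (`|weighted_integral g|%:E <= \int[mu]_w (`|g w| * K w)%:E)%E.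
Proof.
move=> bg; have ig := integrable_weighted bg.
rewrite -abse_EFin /weighted_integral /Rintegral fineK ?integrable_fin_num//.
rewrite (le_trans (le_abse_integral _ measurableT (measurable_int mu ig)))//.
rewrite le_eqVlt; apply/orP; left; apply/eqP; apply: eq_integral => w _ /=.
by rewrite normrM (ger0_norm (K0 w)).
Qed.

Lemma weighted_integral_cvg (g_ : nat -> T -> R) g B :
  (forall m, measurable_fun setT (g_ m)) -> measurable_fun setT g ->
  (forall m w, `|g_ m w| <= B) ->
  {ae mu, forall w, g_ m w @[m --> \oo] --> g w} ->
  weighted_integral (g_ m) @[m --> \oo] --> weighted_integral g.
Proof.
move=> mg_ mg gB cg.
have mgK g' : measurable_fun setT g' -> measurable_fun setT (fun w => (g' w * K w)%:E).
  by move=> mg'; apply/measurable_EFinP; exact: measurable_funM.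
have cgK : {ae mu, forall w, setT w ->
    (g_ m w * K w)%:E @[m --> \oo] --> (g w * K w)%:E}.
  apply: filterS cg => w gw _; apply: cvg_EFin; first exact: nearW.
  exact: cvgMr_tmp.
have gK : {ae mu, forall w (m : nat), setT w -> (`|(g_ m w * K w)%:E| <= (B * K w)%:E)%E}.
  by apply: aeW => w m _; rewrite abse_EFin lee_fin normrM (ger0_norm (K0 w)) ler_wpM2r.
have [ig _ cvi] := dominated_convergence measurableT (fun m => mgK _ (mg_ m)) (mgK _ mg) cgK
  (integrable_weighted (bounded_measurable_cst B)) gK.
have wE : (\int[mu]_w (g w * K w)%:E = (weighted_integral g)%:E)%E.
  by rewrite fineK// (integrable_fin_num _ ig).
by rewrite wE in cvi; exact: fine_cvg cvi.
Qed.

End weighted_integral.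

Section bump.
Context {R : realType} {V : normedModType R}.
Implicit Types (r : R) (w : V).

(** An unnormalised kernel.  Lipschitz regularity suffices, since
    derivatives will fall on the mollified function. *)
Definition bump r w : R := Num.max 0 (r - `|w|).

Lemma bump_ge0 r w : 0 <= bump r w. Proof. by rewrite /bump le_max lexx. Qed.

Lemma bump_le r w : 0 <= r -> bump r w <= r.
Proof. by move=> r0; rewrite /bump ge_max r0 gerBl normr_ge0. Qed.

Lemma bump_eq0 r w : r <= `|w| -> bump r w = 0.
Proof. by move=> rw; rewrite /bump; apply/max_idPl; rewrite subr_le0. Qed.

Lemma bump_ge r w : r - `|w| <= bump r w.
Proof. by rewrite /bump le_max lexx orbT. Qed.

Lemma bump_lipschitz r w w' : `|bump r w - bump r w'| <= `|w - w'|.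
Proof.
have d1 := ler_dist_dist w w'.
move: d1; rewrite !ler_norml /bump; case: (leP 0 (r - `|w|)); case: (leP 0 (r - `|w'|)) => h1 h2 /andP[a b];
  apply/andP; split; lra.
Qed.

Lemma continuous_bump r : continuous (@bump r).
Proof.
apply: (@lipschitz_continuous _ _ _ 1) => // w w'.
by rewrite mul1r; exact: bump_lipschitz.
Qed.

End bump.

Section rV_box.
Context {R : realType} {n : nat}.
Implicit Types (r : R) (x w : 'rV[R]_n).

Lemma coord_le_norm x i : `|x ord0 i| <= `|x|.
Proof.
rewrite [leRHS]/Num.norm/= mx_normrE; apply: le_trans (le_bigmax _ _ (ord0, i)).
exact: lexx.
Qed.

Lemma norm_le_coordP x r : 0 <= r -> (`|x| <= r <-> forall i, `|x ord0 i| <= r).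
Proof.
move=> r0; split=> [xr i|xr]; first exact: le_trans (coord_le_norm _ _) xr.
rewrite [leLHS]/Num.norm/= mx_normrE; apply/bigmax_leP; split=> //= -[i j] _.
by rewrite ord1.
Qed.

Lemma measurable_box r : measurable [set x : 'rV[R]_n | `|x| <= r].
Proof.
have -> : [set x : 'rV[R]_n | `|x| <= r] = ~` [set x | r < `|x|].
  by apply/seteqP; split => x /=; rewrite leNgt => /negP.
apply: measurableC; apply: open_measurable_rV.
apply: (@open_comp _ _ (fun x : 'rV[R]_n => `|x|) [set s | r < s]); last exact: open_gt.
by move=> x _; exact: norm_continuous.
Qed.

Lemma compact_box r : compact [set x : 'rV[R]_n | `|x| <= r].
Proof.
apply: bounded_closed_compact.
  by exists r; split; [exact: num_real|move=> a ra x /le_trans; apply; exact: ltW].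
apply: (@preimage_closed _ _ (fun x : 'rV[R]_n => `|x|) [set t | t <= r]).
  by move=> x _; exact: norm_continuous.
exact: closed_le.
Qed.
(** For the sup norm a ball is a cube. *)
Lemma lebesgue_rV_ball r : 0 <= r ->
  lebesgue_rV n [set x | `|x| <= r] = ((2 * r) ^+ n)%:E.
Proof.
move=> r0.
have -> : [set x : 'rV[R]_n | `|x| <= r] =
    [set x | forall i, `[- r, r]%classic (x ord0 i)].
  apply/seteqP; split => x /=.
    by move=> /(norm_le_coordP _ r0) h i; rewrite in_itv/= -ler_norml.
  move=> h; apply/(norm_le_coordP _ r0) => i.
  by have := h i; rewrite in_itv/= -ler_norml.
rewrite (@lebesgue_rV_box R n (fun=> `[- r, r]%classic) (fun=> measurable_itv _)).
rewrite (eq_bigr (fun=> (2 * r)%:E)) => [|i _].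
  by rewrite prodEFin prodr_const card_ord.
rewrite /= lebesgue_measure_itv/= lte_fin.
case: ifPn => [_|]; first by rewrite -EFinB; congr EFin; ring.
rewrite -leNgt => h; have -> : r = 0 by lra.
by rewrite mulr0.
Qed.

Lemma measurable_bump r : measurable_fun setT (@bump R 'rV[R]_n r).
Proof. apply: continuous_measurable_rV; exact: continuous_bump. Qed.

Lemma integrable_bump r : 0 < r ->
  (@lebesgue_rV R n).-integrable setT (EFin \o bump r).
Proof.
move=> r0; pose B := [set x : 'rV[R]_n | `|x| <= r].
have mB : measurable B by exact: measurable_box.
have iB : (@lebesgue_rV R n).-integrable setT (fun x => (\1_B x)%:E).
  apply/integrableP; split; first by apply/measurable_EFinP; exact: measurable_indic.
  under eq_integral do rewrite /= ger0_norm//.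
  by rewrite integral_indic// setIT [ltLHS](lebesgue_rV_ball (ltW r0)) ltry.
apply: (le_integrable measurableT _ _ (integrableZl measurableT r iB)).
- by apply/measurable_EFinP; exact: measurable_bump.
- move=> x _; rewrite /= lee_fin ger0_norm ?bump_ge0// ger0_norm; last first.
    by rewrite mulr_ge0 ?(ltW r0).
  rewrite indicE; have [xr|xr] := leP `|x| r.
    by rewrite mem_set//= mulr1 bump_le// ltW.
  by rewrite bump_eq0 ?(ltW xr)// mulr_ge0// ltW.
Qed.

Lemma integral_bump_gt0 r : 0 < r ->
  (0 < \int[lebesgue_rV n]_w (bump r w)%:E)%E.
Proof.
move=> r0; have r20 : 0 < r / 2 by rewrite divr_gt0.
apply: (@lt_le_trans _ _ (\int[lebesgue_rV n]_(w in [set w | (`|w| <= r / 2)%R]) (r / 2)%:E)%E).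
  rewrite integral_cst; last exact: measurable_box.
  rewrite [X in (_ * X)%E](lebesgue_rV_ball (ltW r20)) -EFinM lte_fin mulr_gt0// exprn_gt0//.
  by rewrite mulr_gt0.
apply: (@le_trans _ _ (\int[lebesgue_rV n]_(w in [set w | (`|w| <= r / 2)%R]) (bump r w)%:E)%E).
  apply: ge0_le_integral => //.
  - exact: measurable_box.
  - by move=> w _; rewrite lee_fin ltW.
  - by apply/measurable_EFinP/measurable_funTS; exact: measurable_bump.
  - move=> w /= wr; rewrite lee_fin (le_trans _ (bump_ge _ _))//; lra.
apply: ge0_subset_integral => //.
- exact: measurable_box.
- by apply/measurable_EFinP; exact: measurable_bump.
- by move=> w _; rewrite lee_fin bump_ge0.
Qed.

Lemma integral_rV_translate (a : 'rV[R]_n) (g : 'rV[R]_n -> \bar R) :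
  measurable_fun setT g ->
  (\int[lebesgue_rV n]_x g (a + x)%R = \int[lebesgue_rV n]_x g x)%E.
Proof.
move=> mg; rewrite integralE [RHS]integralE.
congr (_ - _)%E.
  rewrite -(ge0_integral_rV_translate a (measurable_funepos mg) (funepos_ge0 g)).
  by apply: eq_integral => x _; rewrite !funeposE.
rewrite -(ge0_integral_rV_translate a (measurable_funeneg mg) (funeneg_ge0 g)).
by apply: eq_integral => x _; rewrite !funenegE.
Qed.

End rV_box.

(** By Lagrange's identity the difference of the squares is half the sum of the
    [(v i * u j - v j * u i) ^ 2]. *)
Lemma cauchy_schwarz {R : realType} {n : nat} (v u : 'rV[R]_n) :
  `|\sum_i v ord0 i * u ord0 i| <= enorm v * enorm u.
Proof.
have s0 (x : 'rV[R]_n) : 0 <= \sum_i x ord0 i ^+ 2.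
  by apply: sumr_ge0 => i _; exact: sqr_ge0.
rewrite /enorm -sqrtrM// -[leLHS]sqrtr_sqr ler_wsqrtr//.
have : 0 <= \sum_i \sum_j (v ord0 i * u ord0 j - v ord0 j * u ord0 i) ^+ 2.
  by apply: sumr_ge0 => i _; apply: sumr_ge0 => j _; exact: sqr_ge0.
have -> : \sum_i \sum_j (v ord0 i * u ord0 j - v ord0 j * u ord0 i) ^+ 2 =
    2 * ((\sum_i v ord0 i ^+ 2) * (\sum_i u ord0 i ^+ 2)) -
    2 * (\sum_i v ord0 i * u ord0 i) ^+ 2.
  transitivity (\sum_i \sum_j v ord0 i ^+ 2 * u ord0 j ^+ 2 +
    \sum_i \sum_j u ord0 i ^+ 2 * v ord0 j ^+ 2 -
    2 * \sum_i \sum_j (v ord0 i * u ord0 i) * (v ord0 j * u ord0 j)).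
    rewrite mulr_sumr -big_split -sumrB/=; apply: eq_bigr => i _.
    rewrite mulr_sumr -big_split -sumrB/=; apply: eq_bigr => j _; ring.
  rewrite -!big_distrlr/=; ring.
by lra.
Qed.

Section smoothing.
Context {R : realType} {n : nat}.
Variable r : R.
Hypothesis r0 : 0 < r.
Let L := @lebesgue_rV R n.
Let K : 'rV[R]_n -> R := bump r.

Let K0 w : 0 <= K w. Proof. exact: bump_ge0. Qed.
Let iK : L.-integrable setT (EFin \o K). Proof. exact: integrable_bump. Qed.
Let mK : measurable_fun setT K. Proof. exact: measurable_bump. Qed.

Definition smoothing (g : 'rV[R]_n -> R) (x : 'rV[R]_n) : R :=
  weighted_integral L K (fun w : 'rV[R]_n => g (x + w)).

Lemma measurable_translate (x : 'rV[R]_n) :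
  measurable_fun setT (fun w : 'rV[R]_n => x + w).
Proof. exact: measurable_funD_rV. Qed.

Lemma bounded_measurable_translate (g : 'rV[R]_n -> R) x :
  bounded_measurable g -> bounded_measurable (fun w : 'rV[R]_n => g (x + w)).
Proof.
move=> [mg [B gB]]; split; last by exists B.
exact: (measurableT_comp mg (measurable_translate x)).
Qed.

(** The increment [d] is moved from [g], of which only boundedness is known, to the
    kernel, which is Lipschitz; both kernels vanish outside the ball of
    radius [r + 1]. *)
Lemma smoothing_lipschitz_near (g : 'rV[R]_n -> R) B x d : measurable_fun setT g ->
  (forall w, `|g w| <= B) -> `|d| <= 1 ->
  `|smoothing g (d + x) - smoothing g x| <= B * (2 * (r + 1)) ^+ n * `|d|.
Proof.
move=> mg gB d1.
have B0 : 0 <= B by rewrite (le_trans _ (gB 0)).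
have bg : bounded_measurable g by split; [|exists B].
pose phi (w : 'rV[R]_n) := g (x + w) * K (w - d).
have mgx : measurable_fun setT (fun w : 'rV[R]_n => g (x + w)).
  exact: (measurableT_comp mg (measurable_translate x)).
have mphi : measurable_fun setT phi.
  apply: measurable_funM => //; apply: (measurableT_comp mK).
  exact: measurable_funD_rV.
have phiE w : phi (d + w) = g ((d + x) + w) * K w.
  by rewrite /phi addrCA addrA [d + w - d]addrC addKr.
have iphi : L.-integrable setT (EFin \o phi).
  apply/integrableP; split; first exact/measurable_EFinP.
  have mabs : measurable_fun setT (fun w => `|(EFin \o phi) w|%E).
    by apply: measurableT_comp => //; exact/measurable_EFinP.
  rewrite -(integral_rV_translate d mabs).
  have /integrableP[_] := integrable_weighted iK (bounded_measurable_translate (d + x) bg).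
  apply: le_lt_trans; rewrite le_eqVlt; apply/orP; left; apply/eqP.
  by apply: eq_integral => w _; rewrite /= phiE.
have -> : smoothing g (d + x) = \int[L]_w phi w.
  rewrite /Rintegral -(integral_rV_translate d); last exact/measurable_EFinP.
  by rewrite /smoothing /weighted_integral; apply: eq_Rintegral => w _; rewrite phiE.
have igx := integrable_weighted iK (bounded_measurable_translate x bg).
rewrite /smoothing /weighted_integral -RintegralB//.
pose D := [set w : 'rV[R]_n | `|w| <= r + 1].
have mD : measurable D by exact: measurable_box.
have r10 : 0 <= r + 1 by rewrite addr_ge0// ltW.
have idiff : L.-integrable setT (EFin \o (fun w => phi w - g (x + w) * K w)).
  by have := integrableB measurableT iphi igx; apply: eq_integrable => // w _.
rewrite -lee_fin /Rintegral -abse_EFin fineK ?integrable_fin_num//.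
rewrite (le_trans (le_abse_integral _ measurableT (measurable_int L idiff)))//.
apply: (@le_trans _ _ (\int[L]_w ((B * `|d|)%:E * (\1_D w)%:E))%E).
  apply: ge0_le_integral => //.
  - by apply: measurableT_comp => //; exact: measurable_int idiff.
  - by apply/measurable_EFinP; apply: measurable_funM => //; exact: measurable_indic.
  move=> w _; rewrite /= lee_fin /phi -mulrBr normrM indicE.
  have [wD|wD] := leP `|w| (r + 1).
    rewrite mem_set// mulr1 ler_pM// (le_trans (bump_lipschitz _ _ _))//.
    by rewrite addrAC subrr add0r normrN.
  rewrite /K !bump_eq0 ?subrr ?normr0 ?mulr0 ?mulr_ge0//.
    by rewrite ltW// (le_lt_trans _ wD)// lerDl.
  have := ler_dist_dist w d; rewrite ler_norml => /andP[_]; move: wD d1; lra.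
rewrite ge0_integralZl_EFin//; last 2 first.
- by apply/measurable_EFinP; exact: measurable_indic.
- exact: mulr_ge0.
by rewrite integral_indic// setIT [X in (_ * X)%E](lebesgue_rV_ball r10) -EFinM lee_fin mulrAC.
Qed.

Lemma continuous_smoothing (g : 'rV[R]_n -> R) : bounded_measurable g ->
  continuous (smoothing g).
Proof.
move=> [mg [B gB]].
have B0 : 0 <= B by rewrite (le_trans _ (gB 0)).
pose C := B * (2 * (r + 1)) ^+ n + 1.
have C0 : 0 < C.
  by rewrite ltr_pwDr// mulr_ge0// exprn_ge0// mulr_ge0// addr_ge0// ltW.
apply: (lipschitz_near_continuous C0) => x d d1.
have /le_trans := @smoothing_lipschitz_near g B x d mg gB d1; apply.
by rewrite ler_wpM2r// lerDl.
Qed.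

End smoothing.

Section smoothing_lipschitz.
Context {R : realType} {n : nat}.
Variable r : R.
Hypothesis r0 : 0 < r.
Variables (h : 'rV[R]_n -> R) (k : R).
Hypothesis k0 : 0 < k.
Hypothesis lipschitz_h : forall x y, `|h x - h y| <= k * `|x - y|.
Hypothesis bounded_h : exists B, forall x, `|h x| <= B.
Let L := @lebesgue_rV R n.
Let K : 'rV[R]_n -> R := bump r.

Let K0 w : 0 <= K w. Proof. exact: bump_ge0. Qed.
Let iK : L.-integrable setT (EFin \o K). Proof. exact: integrable_bump. Qed.
Let mK : measurable_fun setT K. Proof. exact: measurable_bump. Qed.
Let continuous_h : continuous h. Proof. exact: lipschitz_continuous lipschitz_h. Qed.
Let bm_h : bounded_measurable h.
Proof. by split=> //; exact: continuous_measurable_rV. Qed.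

Lemma ae_translate (P : 'rV[R]_n -> Prop) (x : 'rV[R]_n) :
  {ae L, forall w, P w} -> {ae L, forall w, P (x + w)}.
Proof.
move=> [N [mN N0 PN]]; pose N' := [set w | N (x + w)].
have mN' : measurable N'.
  by rewrite -[X in measurable X]setTI; apply: measurable_translate.
exists N'; split => // [|w /= Pw]; last exact: PN.
have mgN : measurable_fun setT (fun w => (\1_N w)%:E : \bar R).
  by apply/measurable_EFinP; exact: measurable_indic.
have gN0 w : (0 <= (\1_N w)%:E :> \bar R)%E by rewrite lee_fin.
have := ge0_integral_rV_translate x mgN gN0.
rewrite (integral_indic _ measurableT mN) setIT [X in _ = X -> _]N0 => <-.
transitivity (\int[L]_w (\1_N' w)%:E)%E; last exact: eq_integral.
by rewrite (integral_indic _ measurableT mN') setIT.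
Qed.

Lemma difference_quotient_bounded (v : 'rV[R]_n) t x :
  `|difference_quotient h v t x| <= k * `|v|.
Proof.
have [->|t0] := eqVneq t 0.
  by rewrite /difference_quotient invr0 mul0r normr0 mulr_ge0// ltW.
rewrite normrM normfV ler_pdivrMl ?normr_gt0//.
by rewrite (le_trans (lipschitz_h _ _))// addrK normrZ mulrCA.
Qed.

(** Where the derivative does not exist it equals the default value [point],
    which therefore enters the bound. *)
Lemma derive_bounded (v : 'rV[R]_n) : bounded_measurable ('D_v h).
Proof.
split; first exact: measurable_derive.
exists (Num.max (k * `|v|) `|point : R|) => x; rewrite le_max.
have [dx|ndx] := pselect (derivable h x v); last first.
  by rewrite /derive dvgP// lexx orbT.
apply/orP; left; have /cvg_ex[l hl] := dx; rewrite /derive (cvg_lim _ hl)//.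
rewrite leNgt; apply/negP => kl.
have [t /= lt] := filter_ex (cvgr_norm_gt _ hl _ kl).
by have := difference_quotient_bounded v t x; rewrite leNgt => /negP; apply.
Qed.

Lemma smoothing_difference_quotient (v : 'rV[R]_n) t x :
  difference_quotient (smoothing r h) v t x =
  weighted_integral L K (fun w : 'rV[R]_n => difference_quotient h v t (x + w)).
Proof.
have b1 := bounded_measurable_translate (t *: v + x) bm_h.
have b2 := bounded_measurableZ (-1) (bounded_measurable_translate x bm_h).
have -> : (fun w : 'rV[R]_n => difference_quotient h v t (x + w)) =
    fun w => t^-1 * (h (t *: v + x + w) + -1 * h (x + w)).
  by apply/funext => w; rewrite /difference_quotient addrA mulN1r.
rewrite (weighted_integralZ iK _ (bounded_measurableD b1 b2)).
rewrite (weighted_integralD iK b1 b2).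
rewrite (weighted_integralZ iK _ (bounded_measurable_translate x bm_h)) mulN1r.
by [].
Qed.

(** The difference quotients of [h] are bounded by [k * |v|] and converge almost
    everywhere, so the limit passes under the integral. *)
Lemma smoothing_is_derive (v x : 'rV[R]_n) : v != 0 ->
  is_derive x v (smoothing r h) (smoothing r ('D_v h) x).
Proof.
move=> v0; apply/is_deriveE/cvgr_dnbhsP => u [u0 cu].
rewrite (_ : (fun m => _) = (fun m => weighted_integral L K
  (fun w : 'rV[R]_n => difference_quotient h v (u m) (x + w)))); last first.
  by apply/funext => m; rewrite -smoothing_difference_quotient.
apply: (weighted_integral_cvg K0 iK (B := k * `|v|)).
- move=> m.
  have mq : measurable_fun setT (difference_quotient h v (u m)).
    by apply: continuous_measurable_rV; exact: continuous_difference_quotient.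
  exact: (measurableT_comp mq (measurable_translate x)).
- exact: (measurableT_comp (measurable_derive continuous_h v) (measurable_translate x)).
- by move=> m w; exact: difference_quotient_bounded.
have := ae_translate x (ae_derivable k0 lipschitz_h v0).
apply: filterS => w /cvg_ex[l hl].
rewrite /derive (cvg_lim _ hl)//.
by move/cvgr_dnbhsP : hl; apply; split.
Qed.

End smoothing_lipschitz.

Lemma segmentE {R : realType} {V : lmodType R} (x y : V) (t : R) :
  (1 - t) *: x + t *: y = x + t *: (y - x).
Proof. by rewrite scalerBl scale1r scalerBr addrA addrAC. Qed.

Lemma continuous_line {R : realType} {V : normedModType R} (x v : V) :
  continuous (fun t : R => x + t *: v).
Proof.
by move=> t; apply: cvgD; [exact: cvg_cst|apply: cvgZr_tmp; exact: cvg_id].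
Qed.

Lemma enormN {R : realType} {n : nat} (x : 'rV[R]_n) : enorm (- x) = enorm x.
Proof. by congr Num.sqrt; apply: eq_bigr => i _; rewrite mxE sqrrN. Qed.

Lemma measurable_enorm_gradient {R : realType} {n : nat} (h : 'rV[R]_n -> R) :
  continuous h -> measurable_fun setT (fun x => enorm (gradient h x)).
Proof.
move=> ch; apply: (measurableT_comp measurable_enorm); apply: measurable_fun_rV => i.
by under eq_fun do rewrite mxE; exact: measurable_derive.
Qed.

Section smoothing_segment.
Context {R : realType} {n : nat}.
Variable r : R.
Hypothesis r0 : 0 < r.
Variables (h : 'rV[R]_n -> R) (k : R).
Hypothesis k0 : 0 < k.
Hypothesis lipschitz_h : forall x y, `|h x - h y| <= k * `|x - y|.
Hypothesis bounded_h : exists B, forall x, `|h x| <= B.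
Let L := @lebesgue_rV R n.
Let K : 'rV[R]_n -> R := bump r.
Let K0 w : 0 <= K w. Proof. exact: bump_ge0. Qed.
Let iK : L.-integrable setT (EFin \o K). Proof. exact: integrable_bump. Qed.
Let mK : measurable_fun setT K. Proof. exact: measurable_bump. Qed.
Let continuous_h : continuous h. Proof. exact: lipschitz_continuous lipschitz_h. Qed.
Let e_ := @basis_vec R n.
Let D_ i := 'D_(e_ i) h.
Let bD i : bounded_measurable (D_ i).
Proof. exact: derive_bounded k0 lipschitz_h _. Qed.

Let is_derive_smoothing i x :
  is_derive x (e_ i) (smoothing r h) (smoothing r (D_ i) x).
Proof.
apply: (smoothing_is_derive r0 k0 lipschitz_h bounded_h).
apply/eqP => /rowP/(_ i); rewrite !mxE !eqxx/= => /eqP.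
by rewrite oner_eq0.
Qed.

Let derive_smoothing i : 'D_(e_ i) (smoothing r h) = smoothing r (D_ i).
Proof. by apply/funext => x; have [_] := is_derive_smoothing i x. Qed.

Let G x := enorm (gradient h x).

Lemma smoothing_line_derive (x v : 'rV[R]_n) (t : R) :
  is_derive t 1 (fun s : R => smoothing r h (x + s *: v))
    (\sum_i v ord0 i * smoothing r (D_ i) (x + t *: v)).
Proof.
have d i y : derivable (smoothing r h) y (e_ i) by have [] := is_derive_smoothing i y.
have c i : continuous ('D_(e_ i) (smoothing r h)).
  by rewrite derive_smoothing; exact: continuous_smoothing.
have := is_derive_C1 d c (x + t *: v) v.
under eq_bigr do rewrite [X in _ * X](congr1 (@^~ _) (derive_smoothing _)).
exact: (proj1 (is_derive_line _ x v t _)).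
Qed.

Lemma smoothing_line_derive_continuous (x v : 'rV[R]_n) :
  continuous (fun t : R => \sum_i v ord0 i * smoothing r (D_ i) (x + t *: v)).
Proof.
have cs i : continuous (fun t : R => v ord0 i * smoothing r (D_ i) (x + t *: v)).
  move=> t; apply: cvgMl_tmp.
  exact: (continuous_comp (@continuous_line _ _ _ _ _) (@continuous_smoothing _ _ _ r0 _ (bD i) _)).
rewrite (_ : (fun t : R => _) =
    \sum_i (fun t : R => v ord0 i * smoothing r (D_ i) (x + t *: v))).
  apply: (@big_ind _ (fun g : R -> R => continuous g)) => [t|f g cf cg t|i _]; last exact: cs.
    exact: cvg_cst.
  by apply: cvgD; [exact: cf|exact: cg].
by apply/funext => t; rewrite fct_sumE.
Qed.

(** Cauchy-Schwarz under the integral: the derivative along [v] is the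
    average of the products of [v] with the gradients of [h]. *)
Lemma smoothing_line_derive_le (x v : 'rV[R]_n) :
  (`|\sum_i v ord0 i * smoothing r (D_ i) x|%:E <=
   (enorm v)%:E * \int[L]_w (G (x + w)%R * K w)%:E)%E.
Proof.
have bDx i := bounded_measurable_translate x (bD i).
have [bs <-] := weighted_integral_sum iK (v ord0) bDx.
apply: (le_trans (weighted_integral_normr K0 iK bs)).
have mGK : measurable_fun setT (fun w : 'rV[R]_n => (G (x + w)%R * K w)%:E).
  apply/measurable_EFinP; apply: measurable_funM => //.
  exact: (measurableT_comp (measurable_enorm_gradient continuous_h) (measurable_translate x)).
have GK0 w : (0 <= (G (x + w)%R * K w)%:E)%E by rewrite lee_fin mulr_ge0// sqrtr_ge0.
rewrite -ge0_integralZl_EFin//; last exact: sqrtr_ge0.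
apply: ge0_le_integral => //.
- by move=> w _; rewrite lee_fin mulr_ge0.
- apply/measurable_EFinP; apply: measurable_funM => //.
  by apply: measurableT_comp => //; case: bs.
- exact: measurable_funeM.
move=> w _; rewrite -EFinM lee_fin mulrA ler_wpM2r//.
rewrite (le_trans _ (cauchy_schwarz _ _))// le_eqVlt; apply/orP; left; apply/eqP.
by congr `|_|; apply: eq_bigr => i _; rewrite mxE.
Qed.

(** The smoothed function is C1, so the fundamental theorem of calculus
    applies on every segment, without exceptional segments. *)
Lemma smoothing_segment_le (x y : 'rV[R]_n) :
  (`|smoothing r h x - smoothing r h y|%:E <= (enorm (x - y))%:E *
   \int[lebesgue_measure]_(t in `]0%R, 1%R[)
     \int[L]_w (G ((1 - t) *: x + t *: y + w)%R * K w)%:E)%E.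
Proof.
pose v := y - x; pose phi (t : R) := smoothing r h (x + t *: v).
pose dphi (t : R) := \sum_i v ord0 i * smoothing r (D_ i) (x + t *: v).
have dP (t : R) : is_derive t 1 phi (dphi t) by exact: smoothing_line_derive.
have cd : continuous dphi by exact: smoothing_line_derive_continuous.
have ftc : (\int[lebesgue_measure]_(t in `[0%R, 1%R]) (dphi t)%:E =
    (phi 1)%:E - (phi 0)%:E)%E.
  apply: continuous_FTC2 => //.
  - by apply: continuous_subspaceT => t; exact: cd.
  - have cphi t : {for t, continuous phi}.
      by apply: differentiable_continuous; apply/derivable1_diffP; have [] := dP t.
    split=> [t _||]; first by have [] := dP t.
      by apply: cvg_at_right_filter; exact: cphi.
    by apply: cvg_at_left_filter; exact: cphi.
  - by move=> t _; rewrite derive1E; have [_ ->] := dP t.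
have md : measurable_fun setT dphi by exact: continuous_measurable_fun.
have x0 : smoothing r h x = phi 0 by rewrite /phi scale0r addr0.
have y1 : smoothing r h y = phi 1 by rewrite /phi scale1r /v addrC subrK.
have {}ftc : (\int[lebesgue_measure]_(t in `]0%R, 1%R[) (dphi t)%:E =
    (phi 1)%:E - (phi 0)%:E)%E.
  rewrite -ftc; apply/esym/integral_itv_bndoo.
  by apply/measurable_EFinP; exact: measurable_funTS.
rewrite x0 y1 distrC -abse_EFin EFinB -ftc.
pose F (p : measurableTypeR R * 'rV[R]_n) := (G (x + p.1 *: v + p.2)%R * K p.2)%:E.
have mF : measurable_fun setT F.
  apply/measurable_EFinP; apply: measurable_funM; last exact: measurableT_comp.
  apply: (measurableT_comp (measurable_enorm_gradient continuous_h)).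
  apply: measurable_funD_rV => //; apply: measurable_funD_rV => //.
  exact: measurable_funZ_rV.
have F0 p : (0 <= F p)%E by rewrite lee_fin mulr_ge0// sqrtr_ge0.
pose J (t : measurableTypeR R) := (\int[L]_w F (t, w))%E.
have mJ : measurable_fun setT J by exact: measurable_fun_fubini_tonelli_F.
have J0 t : (0 <= J t)%E by apply: integral_ge0.
have -> : (\int[lebesgue_measure]_(t in `]0%R, 1%R[)
     \int[L]_w (G ((1 - t) *: x + t *: y + w)%R * K w)%:E =
     \int[lebesgue_measure]_(t in `]0%R, 1%R[) J t)%E.
  apply: eq_integral => t _; apply: eq_integral => w _.
  by rewrite segmentE.
have dphiJ t : (`|dphi t|%:E <= (enorm (x - y))%:E * J t)%E.
  by rewrite -opprB enormN; exact: smoothing_line_derive_le.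
move: J mJ J0 dphiJ => J mJ J0 dphiJ.
have mdE : measurable_fun (`]0%R, 1%R[%classic : set (measurableTypeR R))
    (fun t => (dphi t)%:E).
  by apply/measurable_EFinP; exact: measurable_funTS.
have mJ01 : measurable_fun (`]0%R, 1%R[%classic : set (measurableTypeR R)) J.
  exact: measurable_funTS.
have m01 : measurable (`]0%R, 1%R[%classic : set (measurableTypeR R)).
  exact: measurable_itv.
rewrite (le_trans (le_abse_integral _ m01 mdE))//.
rewrite -(ge0_integralZl_EFin _ m01 (fun t _ => J0 t) mJ01 (sqrtr_ge0 _)).
apply: ge0_le_integral => //.
- exact: measurableT_comp.
- exact: measurable_funeM.
by move=> t _; exact: dphiJ.
Qed.

End smoothing_segment.

(** * The inequality for mollified functions *)

Section triple_tonelli.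
Context d1 d2 d3 (T1 : measurableType d1) (T2 : measurableType d2)
  (T3 : measurableType d3) (R : realType).
Variables (m1 : {sigma_finite_measure set T1 -> \bar R})
  (m2 : {sigma_finite_measure set T2 -> \bar R})
  (m3 : {sigma_finite_measure set T3 -> \bar R}).
Local Open Scope ereal_scope.

Variable psi : (T1 * T2) * T3 -> \bar R.
Hypotheses (mpsi : measurable_fun setT psi) (psi0 : forall u, 0 <= psi u).

Let chi (u : (T1 * T3) * T2) := psi ((u.1.1, u.2), u.1.2).
Let chi0 u : 0 <= chi u. Proof. exact: psi0. Qed.
Let mchi : measurable_fun setT chi.
Proof.
apply: (measurableT_comp mpsi); apply: measurable_fun_pair.
  apply: measurable_fun_pair => //.
  exact: (measurableT_comp measurable_fst measurable_fst).
exact: (measurableT_comp measurable_snd measurable_fst).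
Qed.

Let inner (u : T1 * T3) := \int[m2]_y chi (u, y).
Let inner0 u : 0 <= inner u. Proof. by apply: integral_ge0. Qed.
Let minner : measurable_fun setT inner.
Proof. exact: (measurable_fun_fubini_tonelli_F chi mchi chi0). Qed.

Lemma measurable_triple_tonelli :
  measurable_fun setT (fun t => \int[m1]_x \int[m2]_y psi ((x, y), t)).
Proof. exact: (measurable_fun_fubini_tonelli_G inner minner inner0). Qed.

(** The variable [t] is moved outwards past [y] and then past [x], so each
    exchange involves two of the given sigma-finite measures and never their
    product. *)
Lemma triple_tonelli :
  \int[m1 \x m2]_p \int[m3]_t psi (p, t) =
  \int[m3]_t \int[m1]_x \int[m2]_y psi ((x, y), t).
Proof.
have mF := measurable_fun_fubini_tonelli_F (m2 := m3) psi mpsi psi0.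
have F0 p : 0 <= \int[m3]_t psi (p, t) by apply: integral_ge0.
rewrite (fubini_tonelli1 _ mF F0) /fubini_F.
transitivity (\int[m1]_x \int[m3]_t inner (x, t)).
  apply: eq_integral => x _.
  pose psix (v : T2 * T3) := psi ((x, v.1), v.2).
  have mpsix : measurable_fun setT psix.
    apply: (measurableT_comp mpsi); apply: measurable_fun_pair => //.
    exact: measurable_fun_pair.
  by rewrite (fubini_tonelli psix mpsix (fun v => psi0 _)).
by rewrite (fubini_tonelli _ minner inner0).
Qed.

End triple_tonelli.

Section fatou_bound.
Context d (T : measurableType d) (R : realType).
Local Open Scope ereal_scope.

Lemma fatou_le (mu : {measure set T -> \bar R}) (D : set T)
    (f_ : nat -> T -> \bar R) (f : T -> \bar R) (C : \bar R) :
  measurable D -> (forall m, measurable_fun D (f_ m)) ->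
  (forall m x, D x -> 0 <= f_ m x) ->
  (forall x, D x -> f_ m x @[m --> \oo] --> f x) ->
  (forall m, \int[mu]_(x in D) f_ m x <= C) ->
  \int[mu]_(x in D) f x <= C.
Proof.
move=> mD mf f0 ff fC.
have -> : \int[mu]_(x in D) f x = \int[mu]_(x in D) limn_einf (f_ ^~ x).
  by apply: eq_integral => x /[!inE] Dx; rewrite (cvg_limn_einf_sup (ff x Dx)).1.
apply: (le_trans (fatou _ mD mf f0)).
rewrite limn_einf_lim; apply: lime_le; first exact: is_cvg_einfs.
apply: nearW => m; apply: le_trans (fC m).
by apply: ereal_inf_lbound; exists m => /=.
Qed.

End fatou_bound.

(** The ratio is an open condition that holds at [w = 0], so compactness
    makes it uniform over [A]. *)
Lemma compact_ratio_near {R : realType} {V : normedModType R} (g : V -> R)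
    (A : set V) (e : R) :
  continuous g -> (forall x, 0 < g x) -> compact A -> 0 < e ->
  \forall w \near (0 : V), A `<=` (fun x => g x <= (1 + e) * g (x + w)).
Proof.
move=> cg g0 /compact_near_coveringP cA e0; apply: cA => x Ax.
pose a := (1 + e / 2) * g x.
have [g1 g2] : g x < a /\ a < (1 + e) * g x.
  by have := g0 x; rewrite /a; nra.
have /nbhs_ballP[d /= d0 dg] : nbhs x [set z | a < (1 + e) * g z].
  exact: (cvgr_gt _ (cvgMl_tmp (cg x))).
have d20 : 0 < d / 2 by rewrite divr_gt0.
near=> y w => /=.
apply: (@le_trans _ _ a).
  by apply: ltW; near: y; exact: (cvgr_lt _ (cg x)).
apply: ltW; apply: dg; rewrite -ball_normE/= opprD addrA (splitr d).
apply: (le_lt_trans (ler_normB _ _)); apply: ltrD.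
  by near: y; apply: cvgr_dist_lt; [exact: cvg_id|].
by near: w; exact: nbhs0_lt.
Unshelve. all: by end_near. Qed.

Section mollified_inequality.
Context {R : realType} {n : nat}.
Variable f : 'rV[R]_n -> R.
Hypothesis continuous_f : continuous f.
Hypothesis convex_f : forall x y (t : R), 0 <= t <= 1 ->
  f ((1 - t) *: x + t *: y) <= (1 - t) * f x + t * f y.
Let rho x := expR (- f x).
Variable mu : probability 'rV[R]_n R.
Hypothesis mu_density : forall A : set 'rV[R]_n, measurable A ->
  (mu A = \int[lebesgue_rV n]_(x in A) (rho x)%:E)%E.
Variables (h : 'rV[R]_n -> R) (k : R).
Hypothesis k0 : 0 < k.
Hypothesis lipschitz_h : forall x y, `|h x - h y| <= k * `|x - y|.
Hypothesis bounded_h : exists B, forall x, `|h x| <= B.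
Variable M : R.
Let L := @lebesgue_rV R n.
Let B := [set x : 'rV[R]_n | `|x| <= M].
Let B' := [set x : 'rV[R]_n | `|x| <= M + 1].
Let G x := enorm (gradient h x).
Local Open Scope ereal_scope.

Let mB : measurable B. Proof. exact: measurable_box. Qed.
Let mB' : measurable B'. Proof. exact: measurable_box. Qed.
Let mG : measurable_fun setT G.
Proof.
exact: measurable_enorm_gradient (lipschitz_continuous k0 lipschitz_h).
Qed.
Let mrho : measurable_fun setT rho.
Proof. exact: measurable_density. Qed.

Definition ratio (g : 'rV[R]_n -> R) (p : 'rV[R]_n * 'rV[R]_n) : R :=
  (`|g p.1 - g p.2| / enorm (p.1 - p.2))%R.

Lemma measurable_ratio g : measurable_fun setT g -> measurable_fun setT (ratio g).
Proof.
move=> mg.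
have menorm : measurable_fun setT (fun p : 'rV[R]_n * 'rV[R]_n => enorm (p.1 - p.2)%R).
  apply: (measurableT_comp measurable_enorm); apply: measurable_funD_rV => //.
  by under eq_fun do rewrite -scaleN1r; exact: measurable_funZ_rV.
(* on nonnegative reals, 0 included, the inverse is the real power -1, and
   real powers are measurable *)
have -> : ratio g = (fun p => `|g p.1 - g p.2| * (enorm (p.1 - p.2)) `^ (-1))%R.
  by apply/funext => p; rewrite /ratio powR_inv1// sqrtr_ge0.
apply: measurable_funM; last exact: (measurableT_comp (measurable_powR (-1)%R)).
apply: measurableT_comp => //.
by apply: measurable_funB; exact: measurableT_comp.
Qed.

Section kernel_radius.
Variables (r e : R).
Hypothesis r0 : (0 < r)%R.
Hypothesis r1 : (r <= 1)%R.
Hypothesis e0 : (0 < e)%R.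
Hypothesis rho_ratio : forall x w, B x -> (`|w| < r)%R ->
  (rho x <= (1 + e) * rho (x + w))%R.
Let K : 'rV[R]_n -> R := bump r.
Let c : \bar R := \int[L]_w (K w)%:E.
Let K0 w : (0 <= K w)%R. Proof. exact: bump_ge0. Qed.
Let mK : measurable_fun setT K. Proof. exact: measurable_bump. Qed.
Let GK (p : 'rV[R]_n * 'rV[R]_n) := (G (p.1 + p.2)%R * K p.2)%:E.
(** The average of [|grad h|] near [z], up to the mass [c] of the kernel; the
    indicator in [Gh] confines it to the box where [rho_ratio] holds. *)
Let average (z : 'rV[R]_n) := \int[L]_w GK (z, w).
Let Gh z := (\1_B z)%:E * average z.

Let GK0 p : 0 <= GK p.
Proof. by rewrite lee_fin mulr_ge0// sqrtr_ge0. Qed.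

Let average_ge0 z : 0 <= average z.
Proof. by apply: integral_ge0. Qed.

Let mGK : measurable_fun setT GK.
Proof.
apply/measurable_EFinP; apply: measurable_funM; last exact: measurableT_comp.
by apply: (measurableT_comp mG); exact: measurable_funD_rV.
Qed.

Let mGh : measurable_fun setT Gh.
Proof.
apply: emeasurable_funM; first by apply/measurable_EFinP; exact: measurable_indic.
exact: (measurable_fun_fubini_tonelli_F _ mGK GK0).
Qed.

Let Gh0 z : 0 <= Gh z.
Proof. by rewrite mule_ge0// lee_fin. Qed.

(** Convolving [q] with the kernel multiplies its integral by [c], by
    translation invariance. *)
Let q x := (\1_B' x * G x * rho x)%:E.

Let q0 x : 0 <= q x.
Proof. by rewrite lee_fin !mulr_ge0// ?expR_ge0// sqrtr_ge0. Qed.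

Let mq : measurable_fun setT q.
Proof.
apply/measurable_EFinP; apply: measurable_funM => //.
by apply: measurable_funM => //; exact: measurable_indic.
Qed.

Let qE : \int[L]_x q x = \int[mu]_(x in B') (G x)%:E.
Proof.
pose g x := (G x)%:E * (\1_B' x)%:E.
have mg : measurable_fun setT g.
  apply: emeasurable_funM; first exact/measurable_EFinP.
  by apply/measurable_EFinP; exact: measurable_indic.
have g0 x : 0 <= g x.
  by apply: mule_ge0; rewrite lee_fin ?indicE ?ler0n// sqrtr_ge0.
transitivity (\int[mu]_x g x); last by rewrite [RHS]integral_mkcond epatch_indic.
rewrite (ge0_integral_density mrho (fun x => expR_ge0 _) mu_density mg g0).
by apply: eq_integral => x _; rewrite /q /g -!EFinM [(G x * _)%R]mulrC.
Qed.

Let qK (p : 'rV[R]_n * 'rV[R]_n) := q (p.1 + p.2)%R * (K p.2)%:E.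

Let mqK : measurable_fun setT qK.
Proof.
apply: emeasurable_funM.
  by apply: (measurableT_comp mq); exact: measurable_funD_rV.
by apply/measurable_EFinP; exact: measurableT_comp.
Qed.

Let qK0 p : 0 <= qK p.
Proof. by rewrite mule_ge0// lee_fin. Qed.

Let convolution_qK : \int[L]_z \int[L]_w qK (z, w) =
  c * \int[mu]_(x in B') (G x)%:E.
Proof.
have I0 : 0 <= \int[L]_x q x by apply: integral_ge0.
have KE0 w : 0 <= (K w)%:E by rewrite lee_fin.
have mKE : measurable_fun setT (fun w => (K w)%:E) by exact/measurable_EFinP.
rewrite (fubini_tonelli _ mqK qK0) -qE.
transitivity (\int[L]_w ((K w)%:E * \int[L]_x q x)); last first.
  exact: (ge0_integralZr _ measurableT mKE (fun w _ => KE0 w) I0).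
apply: eq_integral => w _.
have mqw : measurable_fun setT (fun z => q (w + z)%R).
  exact: (measurableT_comp mq (measurable_translate w)).
rewrite -(ge0_integral_rV_translate w mq q0) muleC.
rewrite -(ge0_integralZr _ measurableT mqw (fun z _ => q0 _) (KE0 w)).
by apply: eq_integral => z _; rewrite /qK /= addrC.
Qed.

(** For [z] in the box and [w] in the support of the kernel, [rho z] is at most
    [(1 + e) * rho (z + w)]; so the density can be evaluated at the
    same point as the gradient, and the double integral becomes that of a
    convolution. *)
Lemma integral_average_le :
  \int[mu]_z Gh z <= (1 + e)%:E * (c * \int[mu]_(x in B') (G x)%:E).
Proof.
rewrite -convolution_qK (ge0_integral_density mrho (fun x => expR_ge0 _) mu_density mGh Gh0).
have e10 : (0 <= 1 + e)%R by rewrite addr_ge0// ltW.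
pose Q z := \int[L]_w qK (z, w).
have mQ : measurable_fun setT Q by exact: (measurable_fun_fubini_tonelli_F _ mqK qK0).
have Q0 z : 0 <= Q z by apply: integral_ge0.
rewrite -/(Q _) -(ge0_integralZl_EFin _ measurableT (fun z _ => Q0 z) mQ e10).
apply: ge0_le_integral => //.
- by move=> z _; rewrite mule_ge0// lee_fin expR_ge0.
- by apply: emeasurable_funM => //; exact/measurable_EFinP.
- exact: measurable_funeM.
move=> z _; rewrite /Gh indicE; case: (boolP (z \in B)) => zB; last first.
  by rewrite !mul0e mule_ge0// lee_fin.
rewrite mul1e muleC.
have mGz : measurable_fun setT (fun w => GK (z, w)).
  by apply: (measurableT_comp mGK); exact: measurable_pair1.
have mQz : measurable_fun setT (fun w => qK (z, w)).
  by apply: (measurableT_comp mqK); exact: measurable_pair1.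
rewrite /average -(ge0_integralZl_EFin _ measurableT (fun w _ => GK0 (z, w)) mGz (expR_ge0 _)).
rewrite /Q -(ge0_integralZl_EFin _ measurableT (fun w _ => qK0 (z, w)) mQz e10).
apply: ge0_le_integral => //.
- by move=> w _; rewrite mule_ge0// lee_fin expR_ge0.
- exact: measurable_funeM.
- exact: measurable_funeM.
move=> w _; rewrite /GK /qK /q -!EFinM lee_fin/=.
have [wr|wr] := ltP `|w|%R r; last by rewrite /K bump_eq0// !mulr0.
have zw : B' (z + w)%R.
  rewrite inE in zB; rewrite /B'/= (le_trans (ler_normD _ _))// lerD//.
  by rewrite ltW// (lt_le_trans wr).
rewrite indicE mem_set// mul1r !mulrA ler_wpM2r// mulrAC ler_wpM2r ?sqrtr_ge0//.
by apply: rho_ratio => //; rewrite inE in zB.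
Qed.

Let z_ (p : 'rV[R]_n * 'rV[R]_n) (t : R) := ((1 - t) *: p.1 + t *: p.2)%R.

Let measurable_z : measurable_fun setT
  (fun u : ('rV[R]_n * 'rV[R]_n) * measurableTypeR R => z_ u.1 u.2).
Proof.
apply: measurable_funD_rV; apply: measurable_funZ_rV.
- exact: measurable_funB.
- exact: (measurableT_comp measurable_fst).
- exact: measurable_snd.
- exact: (measurableT_comp measurable_snd).
Qed.

(** The box is convex, so the segment does not leave the set where [Gh] is the
    full average.  On the diagonal the ratio is 0, as the inverse of 0 is. *)
Lemma smoothed_ratio_segment p : (B `*` B) p ->
  (ratio (smoothing r h) p)%:E <=
  \int[lebesgue_measure]_(t in `]0%R, 1%R[) Gh (z_ p t).
Proof.
move=> [/= Bp1 Bp2].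
have -> : \int[lebesgue_measure]_(t in `]0%R, 1%R[) Gh (z_ p t) =
    \int[lebesgue_measure]_(t in `]0%R, 1%R[) average (z_ p t).
  apply: eq_integral => t; rewrite inE/= in_itv/= => /andP[t0 t1].
  rewrite /Gh indicE mem_set ?mul1e// /B/= (le_trans (ler_normD _ _))// !normrZ.
  rewrite (gtr0_norm t0) gtr0_norm ?subr_gt0//.
  have : ((1 - t) * `|p.1| <= (1 - t) * M)%R by rewrite ler_wpM2l// subr_ge0 ltW.
  have : (t * `|p.2| <= t * M)%R by rewrite ler_wpM2l// ltW.
  lra.
rewrite /ratio; have [->|en0] := eqVneq (enorm (p.1 - p.2)) 0%R.
  by rewrite invr0 mulr0; apply: integral_ge0.
have en_gt0 : (0 < enorm (p.1 - p.2))%R by rewrite lt_neqAle eq_sym en0 sqrtr_ge0.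
have := smoothing_segment_le r0 k0 lipschitz_h bounded_h p.1 p.2.
rewrite mulrC EFinM lee_pdivrMl//.
Qed.

Let I01 : set (measurableTypeR R) := `]0%R, 1%R[%classic.
Let mI01 : measurable I01. Proof. exact: measurable_itv. Qed.
Let m1 : measurable_fun setT (fun t : measurableTypeR R => (\1_I01 t)%:E : \bar R).
Proof. by apply/measurable_EFinP; exact: measurable_indic. Qed.
Let i0 (t : measurableTypeR R) : 0 <= (\1_I01 t)%:E :> \bar R.
Proof. by rewrite lee_fin indicE ler0n. Qed.

Let psi (u : ('rV[R]_n * 'rV[R]_n) * measurableTypeR R) :=
  Gh (z_ u.1 u.2) * (\1_I01 u.2)%:E.
Let psi0 u : 0 <= psi u. Proof. by rewrite mule_ge0. Qed.
Let mpsi : measurable_fun setT psi.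
Proof.
apply: emeasurable_funM; first exact: (measurableT_comp mGh measurable_z).
exact: (measurableT_comp m1 measurable_snd).
Qed.

Let Phi p := \int[@lebesgue_measure R]_(t in `]0%R, 1%R[) Gh (z_ p t).
Let PhiE p : Phi p = \int[@lebesgue_measure R]_t psi (p, t).
Proof. by rewrite /Phi integral_mkcond epatch_indic. Qed.
Let Phi0 p : 0 <= Phi p. Proof. by apply: integral_ge0. Qed.
Let mPhi : measurable_fun setT Phi.
Proof.
rewrite (_ : Phi = fun p => \int[@lebesgue_measure R]_t psi (p, t)).
  exact: (measurable_fun_fubini_tonelli_F psi mpsi psi0).
by apply/funext => p; exact: PhiE.
Qed.

(** [interpolation_le] for each fixed [t], once the integral over [t] has been
    moved outside. *)
Lemma integral_segment_le :
  \int[mu \x mu]_p Phi p <= (2 ^+ n)%:E * \int[mu]_z Gh z.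
Proof.
pose C := (2 ^+ n)%:E * \int[mu]_z Gh z.
have C0 : 0 <= C by rewrite mule_ge0 ?lee_fin ?exprn_ge0// integral_ge0.
have -> : \int[mu \x mu]_p Phi p =
    \int[mu \x mu]_p \int[@lebesgue_measure R]_t psi (p, t).
  by apply: eq_integral => p _; exact: PhiE.
rewrite (triple_tonelli mu mu lebesgue_measure mpsi psi0).
apply: (@le_trans _ _ (\int[@lebesgue_measure R]_t ((\1_I01 t)%:E * C))); last first.
  rewrite (ge0_integralZr _ measurableT m1 (fun t _ => i0 t) C0).
  rewrite (integral_indic _ measurableT mI01) setIT [X in X * _]lebesgue_measure_itv/=.
  by rewrite lte_fin ltr01 oppr0 adde0 mul1e.
apply: ge0_le_integral => //.
- by move=> t _; apply: integral_ge0 => x _; exact: integral_ge0.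
- exact: (measurable_triple_tonelli mu mu mpsi psi0).
- exact: emeasurable_funM.
move=> t _.
rewrite indicE; case: (boolP (t \in I01)) => tI; last first.
  rewrite mul0e le_eqVlt; apply/orP; left; apply/eqP.
  rewrite -[RHS](integral0 mu setT); apply: eq_integral => x _.
  rewrite -[RHS](integral0 mu setT); apply: eq_integral => y _.
  by rewrite /psi/= indicE (negbTE tI) mule0.
rewrite mul1e.
have t01 : (0 < t < 1)%R by move: tI; rewrite inE.
have -> : \int[mu]_x \int[mu]_y psi ((x, y), t) =
    \int[mu]_x \int[mu]_y Gh ((1 - t) *: x + t *: y)%R.
  apply: eq_integral => x _; apply: eq_integral => y _.
  by rewrite /psi/= indicE tI mule1.
exact: (interpolation_le continuous_f convex_f mu_density t01 mGh Gh0).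
Qed.

Lemma smoothed_ratio_le :
  \int[mu \x mu]_(p in B `*` B) (ratio (smoothing r h) p)%:E <=
  (2 ^+ n)%:E * ((1 + e)%:E * (c * \int[mu]_(x in B') (G x)%:E)).
Proof.
have mBB : measurable (B `*` B) by exact: measurableX.
have mS : measurable_fun setT (smoothing r h).
  apply: continuous_measurable_rV; apply: continuous_smoothing => //.
  split=> //; apply: continuous_measurable_rV.
  exact: lipschitz_continuous lipschitz_h.
apply: (@le_trans _ _ (\int[mu \x mu]_(p in B `*` B) Phi p)).
  apply: ge0_le_integral => //.
  - by move=> p _; rewrite lee_fin mulr_ge0// invr_ge0 sqrtr_ge0.
  - by apply/measurable_EFinP/measurable_funTS; exact: measurable_ratio.
  - exact: measurable_funTS.
  - exact: smoothed_ratio_segment.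
apply: (@le_trans _ _ (\int[mu \x mu]_p Phi p)).
  exact: (ge0_subset_integral _ mBB measurableT mPhi (fun p _ => Phi0 p)).
apply: (le_trans integral_segment_le).
by apply: lee_wpmul2l; [rewrite lee_fin exprn_ge0|exact: integral_average_le].
Qed.

End kernel_radius.

End mollified_inequality.

(** * Removing the mollifier *)

Section smoothing_limit.
Context {R : realType} {n : nat}.
Variable f : 'rV[R]_n -> R.
Hypothesis continuous_f : continuous f.
Hypothesis convex_f : forall x y (t : R), 0 <= t <= 1 ->
  f ((1 - t) *: x + t *: y) <= (1 - t) * f x + t * f y.
Variable mu : probability 'rV[R]_n R.
Hypothesis mu_density : forall A : set 'rV[R]_n, measurable A ->
  (mu A = \int[lebesgue_rV n]_(x in A) (expR (- f x))%:E)%E.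
Variables (h : 'rV[R]_n -> R) (k : R).
Hypothesis k0 : 0 < k.
Hypothesis lipschitz_h : forall x y, `|h x - h y| <= k * `|x - y|.
Hypothesis bounded_h : exists B, forall x, `|h x| <= B.
Variable M : R.
Let L := @lebesgue_rV R n.
Let B := [set x : 'rV[R]_n | `|x| <= M].
Let B' := [set x : 'rV[R]_n | `|x| <= M + 1].
Let G x := enorm (gradient h x).
Let c r : R := \int[L]_w bump r w.

Let cE r : 0 < r -> (\int[L]_w (bump r w)%:E = (c r)%:E)%E.
Proof. by move=> r0; rewrite fineK// (integrable_fin_num _ (integrable_bump r0)). Qed.

Let c_gt0 r : 0 < r -> 0 < c r.
Proof. by move=> r0; rewrite -lte_fin -cE// integral_bump_gt0. Qed.

Let bm_h : bounded_measurable h.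
Proof.
by split=> //; apply: continuous_measurable_rV; exact: lipschitz_continuous lipschitz_h.
Qed.

Lemma smoothing_near r x : 0 < r ->
  `|smoothing r h x / c r - h x| <= k * r.
Proof.
move=> r0; have iK := integrable_bump (n := n) r0.
have c0 := c_gt0 r0.
have bx := bounded_measurable_translate x bm_h.
have bc : bounded_measurable (fun _ : 'rV[R]_n => - h x) by exact: bounded_measurable_cst.
have -> : smoothing r h x / c r - h x =
    weighted_integral L (bump r) (fun w : 'rV[R]_n => h (x + w) + - h x) / c r.
  rewrite (weighted_integralD iK bx bc) mulrDl; congr (_ + _).
  have -> : weighted_integral L (bump r) (fun=> - h x) = - h x * c r.
    by rewrite /weighted_integral RintegralZl.
  by rewrite mulfK// gt_eqF.
rewrite normrM normfV (gtr0_norm c0) ler_pdivrMr// -lee_fin EFinM -cE//.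
have mK := @measurable_bump R n r.
have b0 (w : 'rV[R]_n) : 0 <= bump r w by exact: bump_ge0.
have := weighted_integral_normr b0 iK (bounded_measurableD bx bc).
move=> /le_trans; apply.
have kr0 : 0 <= k * r by rewrite mulr_ge0// ltW.
rewrite -ge0_integralZl_EFin//; last 2 first.
- by move=> w _; rewrite lee_fin bump_ge0.
- exact/measurable_EFinP.
apply: ge0_le_integral => //.
- by move=> w _; rewrite lee_fin mulr_ge0// bump_ge0.
- apply/measurable_EFinP; apply: measurable_funM => //.
  apply: measurableT_comp => //; apply: measurable_funD => //.
  by case: bx.
- by apply: measurable_funeM; exact/measurable_EFinP.
move=> w _; rewrite -EFinM lee_fin.
have [wr|wr] := ltP `|w| r; last by rewrite bump_eq0// !mulr0.
rewrite ler_wpM2r ?bump_ge0// (le_trans (lipschitz_h _ _))// ler_wpM2l ?(ltW k0)//.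
by rewrite addrAC subrr add0r ltW.
Qed.

(** The smoothed functions divided by [c r] converge to [h] as [r] tends to 0, and
    the bounds of [smoothed_ratio_le], divided by [c r], do not depend on [r];
    Fatou's lemma gives the bound for [h]. *)
Lemma ratio_box_le_eps (e : R) : 0 < e ->
  (\int[mu \x mu]_(p in B `*` B) (ratio h p)%:E <=
   (2 ^+ n)%:E * ((1 + e)%:E * \int[mu]_(x in B') (G x)%:E))%E.
Proof.
move=> e0.
pose rho (x : 'rV[R]_n) := expR (- f x).
have crho : continuous rho.
  move=> x; apply: continuous_comp; last exact: continuous_expR.
  by apply: continuousN; exact: continuous_f.
have cB : compact B by exact: compact_box.
have /nbhs_ballP[s /= s0 rho_s] :=
  compact_ratio_near crho (fun x => expR_gt0 _) cB e0.
(* radii tending to 0, at most 1 so that averages over [B] only see [B'], and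
   at most [s] so that [rho] varies by a factor at most [1 + e] *)
pose s1 := Num.min 1 s; have s10 : 0 < s1 by rewrite lt_min ltr01.
pose r m := s1 / m.+1%:R.
have r0 m : 0 < r m by rewrite divr_gt0.
have rs1 m : r m <= s1 by rewrite ler_pdivrMr// ler_peMr ?ler1n// ltW.
have r1 m : r m <= 1 by rewrite (le_trans (rs1 m))// ge_min lexx.
have rho_ratio m x w : B x -> `|w| < r m -> rho x <= (1 + e) * rho (x + w).
  move=> Bx wr; apply: (rho_s w) => //.
  rewrite -ball_normE/= sub0r normrN (lt_le_trans wr)// (le_trans (rs1 m))//.
  by rewrite ge_min lexx orbT.
have main m := smoothed_ratio_le continuous_f convex_f mu_density k0 lipschitz_h bounded_h
  (r0 m) (r1 m) e0 (rho_ratio m).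
have mBB : measurable (B `*` B) by apply: measurableX; exact: measurable_box.
have mS m : measurable_fun setT (smoothing (r m) h).
  by apply: continuous_measurable_rV; exact: continuous_smoothing.
have ratio_ge0 g p : 0 <= ratio g p by rewrite mulr_ge0// invr_ge0 sqrtr_ge0.
apply: (@fatou_le _ _ _ _ _ (fun m p => ((c (r m))^-1 * ratio (smoothing (r m) h) p)%:E)) => //.
- move=> m; apply/measurable_EFinP/measurable_funTS; apply: measurable_funM => //.
  exact: measurable_ratio.
- move=> m p _; rewrite lee_fin; apply: mulr_ge0; last exact: ratio_ge0.
  by rewrite invr_ge0 ltW// c_gt0.
- move=> p _; apply: cvg_EFin; first exact: nearW.
  have ch x : smoothing (r m) h x / c (r m) @[m --> \oo] --> h x.
    apply/cvgrPdist_le => d d0; near=> m; rewrite distrC.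
    have kd : k * s1 / d <= m%:R by near: m; exact: nbhs_infty_ger.
    rewrite (le_trans (smoothing_near _ (r0 m)))// mulrA ler_pdivrMr//.
    by rewrite ler_pdivrMr// in kd; rewrite (le_trans kd)// mulrC ler_pM2l// ler_nat.
  rewrite [X in X @ _ --> _](_ : _ = (fun m =>
      `|smoothing (r m) h p.1 / c (r m) - smoothing (r m) h p.2 / c (r m)|
        / enorm (p.1 - p.2))); last first.
    apply/funext => m /=; rewrite /ratio mulrA -mulrBl normrM normfV.
    by rewrite (gtr0_norm (c_gt0 (r0 m))) [_^-1 * _]mulrC.
  by apply: cvgMr_tmp; apply: cvg_norm; apply: cvgB; exact: ch.
move=> m.
have mr : measurable_fun (B `*` B) (fun p => (ratio (smoothing (r m) h) p)%:E).
  by apply/measurable_EFinP/measurable_funTS; exact: measurable_ratio.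
have c0 := c_gt0 (r0 m).
have ci0 : 0 <= (c (r m))^-1 by rewrite invr_ge0 ltW.
under eq_integral do rewrite EFinM.
rewrite (ge0_integralZl_EFin _ mBB _ mr ci0); last first.
  by move=> p _; rewrite lee_fin; exact: ratio_ge0.
have := main m; rewrite cE// => /(lee_wpmul2l (x := (c (r m))^-1%:E)).
rewrite lee_fin => /(_ ci0) /le_trans; apply.
rewrite le_eqVlt; apply/orP; left; apply/eqP; rewrite !muleA -!EFinM.
by congr (_%:E * _)%E; field; rewrite gt_eqF.
Unshelve. all: by end_near. Qed.

End smoothing_limit.

(** * Truncation to boxes *)

Lemma lee_mul_1Deps {R : realType} (X I : \bar R) (b : R) :
  (0 <= I)%E -> 0 < b -> (forall e : R, 0 < e -> (X <= b%:E * ((1 + e)%:E * I))%E) ->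
  (X <= b%:E * I)%E.
Proof.
move=> + b0; case: I => [i||//] i0 XI; last first.
  by rewrite gt0_muley ?lte_fin// leey.
rewrite lee_fin in i0.
apply/lee_addgt0Pr => e e0; have bi : 0 < b * i + 1 by rewrite ltr_pwDr// mulr_ge0// ltW.
rewrite (le_trans (XI (e / (b * i + 1)) (divr_gt0 e0 bi)))//.
rewrite -!EFinM -EFinD lee_fin mulrDl mul1r mulrDr lerD2l.
have -> : b * (e / (b * i + 1) * i) = e * ((b * i) / (b * i + 1)).
  by field; rewrite gt_eqF.
by rewrite ler_piMr ?(ltW e0)// ler_pdivrMr// mul1r lerDl.
Qed.

Section lipschitz_box.
Context {R : realType} {n : nat}.
Implicit Types (h : 'rV[R]_n -> R) (x y : 'rV[R]_n).

Lemma enorm_le_norm x : enorm x <= Num.sqrt n%:R * `|x|.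
Proof.
rewrite -[leRHS]ger0_norm; last by rewrite mulr_ge0// sqrtr_ge0.
rewrite -sqrtr_sqr exprMn sqr_sqrtr// ler_wsqrtr//.
rewrite -[n in n%:R]card_ord -sum1_card natr_sum mulr_suml; apply: ler_sum => i _.
rewrite mul1r -real_normK ?num_real// lerXn2r ?nnegrE//; exact: coord_le_norm.
Qed.

Lemma locally_lipschitz_norm h : locally_lipschitz h ->
  forall x, exists2 U, nbhs x U & exists2 k : R, 0 < k &
    forall y z, U y -> U z -> `|h y - h z| <= k * `|y - z|.
Proof.
move=> lh x; have [U xU [k hU]] := lh x; exists U => //.
exists (`|k| * Num.sqrt n%:R + 1).
  by rewrite ltr_pwDr// mulr_ge0// sqrtr_ge0.
move=> y z Uy Uz; rewrite (le_trans (hU y z Uy Uz))// mulrDl mul1r.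
rewrite (@le_trans _ _ (`|k| * Num.sqrt n%:R * `|y - z|)) ?lerDl//.
rewrite -mulrA (le_trans (ler_norm _))// normrM ler_wpM2l//.
by rewrite ger0_norm ?sqrtr_ge0// enorm_le_norm.
Qed.

End lipschitz_box.

Lemma locally_lipschitz_continuous {R : realType} {V : normedModType R} (h : V -> R) :
  (forall x : V, exists2 U : set V, nbhs x U & exists2 k : R, 0 < k &
    forall y z, U y -> U z -> `|h y - h z| <= k * `|y - z|) -> continuous h.
Proof.
move=> lh x; have [U xU [k k0 hU]] := lh x.
apply/cvgrPdist_le => e e0; near=> y.
rewrite (le_trans (hU _ _ (nbhs_singleton xU) _))//; first by near: y; exact: xU.
rewrite mulrC -ler_pdivlMr//; near: y.
by apply: cvgr_dist_le; [exact: cvg_id|exact: divr_gt0].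
Unshelve. all: by end_near. Qed.

(** Pairs close to the diagonal are controlled by the local constants, the
    others by boundedness; compactness of [A `*` A] makes one constant serve
    everywhere. *)
Lemma locally_lipschitz_compact {R : realType} {V : normedModType R} (h : V -> R)
    (A : set V) : continuous h ->
  (forall x : V, exists2 U : set V, nbhs x U & exists2 k : R, 0 < k &
    forall y z, U y -> U z -> `|h y - h z| <= k * `|y - z|) ->
  compact A ->
  exists2 k : R, 0 < k & forall x y : V, A x -> A y -> `|h x - h y| <= k * `|x - y|.
Proof.
move=> ch lh cA.
have cAA : near_covering (A `*` A) by apply/compact_near_coveringP; exact: compact_setX.
have : \forall k \near +oo, A `*` A `<=` (fun p : V * V => `|h p.1 - h p.2| <= k * `|p.1 - p.2|).
  apply: cAA => -[x y] [/= Ax Ay]; have [<-|xy] := eqVneq x y.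
    have [U xU [k k0 hk]] := lh x.
    have UU : nbhs (x, x) (U `*` U) by exists (U, U).
    have kK : \forall K \near +oo, k <= K by apply: nbhs_pinfty_ge; exact: num_real.
    exists (U `*` U, [set K | k <= K]) => // -[p K] /= [[Up1 Up2] kKp].
    by rewrite (le_trans (hk _ _ Up1 Up2))// ler_wpM2r.
  pose d := `|x - y|; have d0 : 0 < d by rewrite normr_gt0 subr_eq0.
  have d40 : 0 < d / 4 by rewrite divr_gt0.
  pose N z := [set z' | `|h z - h z'| <= 1] `&` [set z' | `|z - z'| <= d / 4].
  have nN z : nbhs z (N z).
    apply: filterI; first by apply: cvgr_dist_le; [exact: ch|exact: ltr01].
    by apply: cvgr_dist_le; [exact: cvg_id|exact: d40].
  have NN : nbhs (x, y) (N x `*` N y) by exists (N x, N y).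
  pose k := (`|h x - h y| + 2) / (d / 2).
  have kK : \forall K \near +oo, k <= K by apply: nbhs_pinfty_ge; exact: num_real.
  exists (N x `*` N y, [set K | k <= K]) => // -[p K] /= [[[/= h1 n1] [/= h2 n2]] K0].
  have dp : d / 2 <= `|p.1 - p.2|.
    have := ler_distD p.1 x y; have := ler_distD p.2 p.1 y.
    by rewrite -/d (distrC p.2 y); lra.
  have hp : `|h p.1 - h p.2| <= `|h x - h y| + 2.
    have -> : h p.1 - h p.2 = (h x - h y) - ((h x - h p.1) - (h y - h p.2)) by ring.
    rewrite (le_trans (ler_normB _ _))// lerD2l.
    by rewrite (le_trans (ler_normB _ _))// (_ : 2 = 1 + 1)// lerD.
  rewrite (le_trans hp)//.
  apply: (@le_trans _ _ (K * (d / 2))); first by rewrite -ler_pdivrMr ?divr_gt0.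
  rewrite ler_wpM2l// (le_trans _ K0)//.
  by rewrite divr_ge0 ?addr_ge0// ltW// divr_gt0.
move=> [k0 [_ hk]].
exists (Num.max 1 (k0 + 1)); first by rewrite lt_max ltr01.
move=> x y Ax Ay; apply: (hk _ _ (x, y)) => //.
by rewrite lt_max ltrDl ltr01 orbT.
Qed.

Section clamp.
Context {R : realType} {n : nat}.
Variable M : R.
Hypothesis M0 : 0 <= M.
Implicit Types x y : 'rV[R]_n.

(** The projection onto the box of radius [M]. *)
Definition clamp x : 'rV[R]_n := \row_i Num.max (- M) (Num.min M (x ord0 i)).

Lemma clamp_norm x : `|clamp x| <= M.
Proof.
apply/(norm_le_coordP _ M0) => i; rewrite mxE ler_norml le_max lexx/=.
by rewrite ge_max ge_min lexx andbT/= (le_trans _ M0)// oppr_le0.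
Qed.

Lemma clamp_id x : `|x| <= M -> clamp x = x.
Proof.
move=> /(norm_le_coordP _ M0) xM; apply/rowP => i; rewrite mxE.
by have := xM i; rewrite ler_norml => /andP[a b]; rewrite min_r// max_r.
Qed.

Lemma clamp_lipschitz x y : `|clamp x - clamp y| <= `|x - y|.
Proof.
apply/(norm_le_coordP _ (normr_ge0 _)) => i; rewrite !mxE.
have := coord_le_norm (x - y) i; rewrite !mxE; apply: le_trans.
move: (x ord0 i) (y ord0 i) => a b; have := ler_norm (a - b).
have := ler_norm (b - a); rewrite distrC => h1 h2.
rewrite /= /Num.max /Num.min ler_norml.
by case: (ltP M a); case: (ltP M b) => *; repeat case: ifP => /= [|/negbT];
  rewrite -?leNgt => *; apply/andP; split; lra.
Qed.

End clamp.

Lemma near_norm_lt {R : realType} {V : normedModType R} (M : R) (x : V) :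
  `|x| < M -> \forall y \near x, `|y| < M.
Proof. by move=> xM; apply: (cvgr_lt `|x|) => //; apply: cvg_norm; exact: cvg_id. Qed.

Section truncation.
Context {R : realType} {n : nat}.
Variable f : 'rV[R]_n -> R.
Hypothesis continuous_f : continuous f.
Hypothesis convex_f : forall x y (t : R), 0 <= t <= 1 ->
  f ((1 - t) *: x + t *: y) <= (1 - t) * f x + t * f y.
Variable mu : probability 'rV[R]_n R.
Hypothesis mu_density : forall A : set 'rV[R]_n, measurable A ->
  (mu A = \int[lebesgue_rV n]_(x in A) (expR (- f x))%:E)%E.
Variable h : 'rV[R]_n -> R.
Hypothesis lipschitz_h : locally_lipschitz h.
Let ln := locally_lipschitz_norm lipschitz_h.
Let ch : continuous h. Proof. exact: locally_lipschitz_continuous. Qed.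
Let box (M : R) := [set x : 'rV[R]_n | `|x| <= M].
Let G x := enorm (gradient h x).

Lemma near_clamp (M : R) (x : 'rV[R]_n) : `|x| < M -> \forall y \near x, clamp M y = y.
Proof.
move=> /near_norm_lt; apply: filterS => y yM; apply: clamp_id; last exact: ltW.
by rewrite (le_trans (normr_ge0 y))// ltW.
Qed.

(** Composing [h] with the projection onto the box of radius [M + 2] makes it
    bounded and Lipschitz without changing it near the box of radius [M + 1],
    so neither the difference quotients nor the gradients involved change. *)
Lemma ratio_box_le (M : R) : 0 <= M ->
  (\int[mu \x mu]_(p in box M `*` box M) (ratio h p)%:E <=
   (2 ^+ n)%:E * \int[mu]_x (G x)%:E)%E.
Proof.
move=> M0; pose N := M + 2; have N0 : 0 <= N by rewrite addr_ge0.
have cN : compact (box N) by exact: compact_box.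
have [k k0 hk] := locally_lipschitz_compact ch ln cN.
pose g x := h (clamp N x).
have lip_g x y : `|g x - g y| <= k * `|x - y|.
  rewrite (le_trans (hk _ _ (clamp_norm N0 x) (clamp_norm N0 y)))//.
  by rewrite ler_wpM2l ?(ltW k0)// clamp_lipschitz.
have bound_g : exists b, forall x, `|g x| <= b.
  exists (`|h 0| + k * N) => x.
  have n0 : box N 0 by rewrite /box/= normr0.
  rewrite -(subrK (h 0) (g x)) addrC (le_trans (ler_normD _ _))// lerD2l.
  rewrite (le_trans (hk _ _ (clamp_norm N0 x) n0))// subr0.
  by rewrite ler_wpM2l ?(ltW k0)// clamp_norm.
have gE x : `|x| <= M -> g x = h x.
  by move=> xM; rewrite /g clamp_id// (le_trans xM)// lerDl.
have GE x : box (M + 1) x -> gradient g x = gradient h x.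
  move=> xM; apply/rowP => i; rewrite !mxE; apply: near_eq_derive.
  have xN : `|x| < N by rewrite (le_lt_trans xM)// ltrD2l ltr1n.
  by apply: filterS (near_clamp xN) => y cy; rewrite /g cy.
have mbox : measurable (box (M + 1)) by exact: measurable_box.
have mG : measurable_fun setT (fun x => (G x)%:E).
  by apply/measurable_EFinP; exact: measurable_enorm_gradient.
have G0 x : (0 <= (G x)%:E)%E by rewrite lee_fin sqrtr_ge0.
apply: (@le_trans _ _ ((2 ^+ n)%:E * \int[mu]_(x in box (M + 1)) (G x)%:E)%E).
  apply: lee_mul_1Deps => [||e e0]; first exact: integral_ge0.
    by rewrite exprn_gt0.
  have := ratio_box_le_eps continuous_f convex_f mu_density k0 lip_g bound_g M e0.
  rewrite (eq_integral (fun p => (ratio h p)%:E)); last first.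
    by move=> p /[!inE] -[p1 p2]; rewrite /ratio !gE.
  rewrite (eq_integral (fun x => (G x)%:E))// => x /[!inE] xM.
  by rewrite /G GE.
apply: lee_wpmul2l; first by rewrite lee_fin exprn_ge0.
apply: ge0_subset_integral => [|||x _|]; [exact: mbox|exact: measurableT|exact: mG|exact: G0|exact: subsetT].
Qed.

Lemma ratio_le :
  (\int[mu \x mu]_p (ratio h p)%:E <= (2 ^+ n)%:E * \int[mu]_x (G x)%:E)%E.
Proof.
have mR : measurable_fun setT (ratio h).
  by apply: measurable_ratio; exact: continuous_measurable_rV.
pose D (m : nat) := box m%:R `*` box m%:R.
have mD m : measurable (D m) by apply: measurableX; exact: measurable_box.
have ratio_ge0 p : 0 <= ratio h p by rewrite mulr_ge0// invr_ge0 sqrtr_ge0.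
pose r (p : 'rV[R]_n * 'rV[R]_n) := (ratio h p)%:E.
pose F m := r \_ (D m).
have mr : measurable_fun setT r by exact/measurable_EFinP.
have mF m : measurable_fun setT (F m).
  by apply/(measurable_restrictT _ (mD m)); exact: measurable_funTS.
apply: (@fatou_le _ _ _ _ _ F _ _ measurableT mF).
- move=> m p _; apply: erestrict_ge0 => q _; rewrite lee_fin; exact: ratio_ge0.
- move=> p _; apply: cvg_near_cst; near=> m; rewrite /F patchE mem_set//.
  have : `|p.1| + `|p.2| <= m%:R by near: m; exact: nbhs_infty_ger.
  by move=> pm; split; rewrite /box/= (le_trans _ pm)// ?lerDl ?lerDr.
- by move=> m; rewrite -integral_mkcond; exact: ratio_box_le.
Unshelve. all: by end_near. Qed.

End truncation.

Theorem theorem1p2 (R : realType) (n : nat) (n_ge1 : (1 <= n)%N)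
    (f : 'rV[R]_n -> R)
    (f_C2 : of_class_C 2 f)
    (f_hessian : forall x : 'rV[R]_n, posdefmx (hessian f x))
    (f_int1 : (\int[lebesgue_rV n]_x (expR (- f x))%:E = 1)%E)
    (mu : probability 'rV[R]_n R)
    (mu_density : forall A : set 'rV[R]_n, measurable A ->
      (mu A = \int[lebesgue_rV n]_(x in A) (expR (- f x))%:E)%E)
    (h : 'rV[R]_n -> R) (h_lip : locally_lipschitz h) :
  (\int[mu]_y \int[mu]_x (`|h x - h y| / enorm (x - y))%:E
     <= (2 ^+ n)%:E * \int[mu]_x (enorm (gradient h x))%:E)%E.
Proof.
have cf : continuous f by case: f_C2.
have ch := locally_lipschitz_continuous (locally_lipschitz_norm h_lip).
have convex_f := posdef_hessian_convex f_C2 f_hessian.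
pose r (p : 'rV[R]_n * 'rV[R]_n) := (ratio h p)%:E.
have mr : measurable_fun setT r.
  apply/measurable_EFinP; apply: measurable_ratio.
  exact: (continuous_measurable_rV ch).
have r0 p : (0 <= r p)%E by rewrite lee_fin mulr_ge0// invr_ge0 sqrtr_ge0.
have rle := ratio_le cf convex_f mu_density h_lip.
have := fubini_tonelli2 (m1 := mu) (m2 := mu) r mr r0.
by rewrite /fubini_G /r /= => rE; rewrite rE in rle.
Qed.
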